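(* Let $H=([t],E)$ be a $3$-uniform hypergraph on $[t]$. For $f:\{0,1\}^n\to\{-1,1\}$ consider the test: choose $x_1,\dots,x_t\in\{0,1\}^n$ independently and uniformly, and accept iff for every edge $e=\{i,j,k\}\in E$, $$f(x_i)f(x_j)f(x_k)f(x_i+x_j)f(x_i+x_k)f(x_j+x_k)f(x_i+x_j+x_k)=f(0).$$ Then (i) if $f=(-1)^{P}$ for a polynomial $P$ over $\mathbb F_2$ of degree at most $2$, the test accepts $f$ with probability $1$; and (ii) there is a function $\phi:(0,1/2]\to[0,\infty)$ with $\phi(\epsilon)\to0$ as $\epsilon\to0$, independent of $n$, $t$ and $H$, such that whenever $f$ is at distance at least $\frac12-\epsilon$ from every quadratic polynomial function, the test accepts $f$ with probability at most $\frac{1}{2^{|E|}}+\phi(\epsilon)$.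
   Context: $\{0,1\}^n$ is identified with $\mathbb F_2^n$. A quadratic polynomial function is $g(x)=(-1)^{P(x)}$ with $P$ an $n$-variate polynomial over $\mathbb F_2$ of degree at most $2$. The distance between two functions $\{0,1\}^n\to\{-1,1\}$ is the fraction of points where they differ. *)

(* Defs.v *)
From HB Require Import structures.
From mathcomp Require Import all_boot all_order all_algebra.
From mathcomp Require Import mpoly.
Set Implicit Arguments. Unset Strict Implicit. Unset Printing Implicit Defensive.
Import Order.TTheory GRing.Theory Num.Theory.
Local Open Scope ring_scope.

(* {0,1}^n identified with F_2^n, realised as row vectors 'rV['F_2]_n. *)
Notation pt n := 'rV['F_2]_n.

Definition sgnF2 (R : ringType) (b : 'F_2) : R := if b == 0 then 1 else -1.

(* g = (-1)^P, P an n-variate polynomial over F_2 of degree at most 2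
   (msize p = 1 + total degree, 0 for p = 0). *)
Definition quad_fun (R : ringType) (n : nat) (g : pt n -> R) : Prop :=
  exists P : {mpoly 'F_2[n]}, (msize P <= 3)%N /\
    forall x : pt n, g x = sgnF2 R (P.@[fun i => x ord0 i]).

Definition dist (R : numFieldType) (n : nat) (f g : pt n -> R) : R :=
  #|[set x : pt n | f x != g x]|%:R / #|{: pt n}|%:R.

Definition edge_ok (R : ringType) (n : nat) (f : pt n -> R) (xi xj xk : pt n) : bool :=
  f xi * f xj * f xk * f (xi + xj) * f (xi + xk) * f (xj + xk) * f (xi + xj + xk)
  == f 0.

Definition accepts (R : ringType) (n t : nat) (E : {set {set 'I_t}})
  (f : pt n -> R) (xs : {ffun 'I_t -> pt n}) : bool :=
  [forall e in E, forall i, forall j, forall k,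
     (e == [set i; j; k]) ==> edge_ok f (xs i) (xs j) (xs k)].

Definition acc_prob (R : numFieldType) (n t : nat) (E : {set {set 'I_t}})
  (f : pt n -> R) : R :=
  #|[set xs : {ffun 'I_t -> pt n} | accepts E f xs]|%:R
    / #|{: {ffun 'I_t -> pt n}}|%:R.

Definition three_uniform (t : nat) (E : {set {set 'I_t}}) : Prop :=
  forall e, e \in E -> #|e| = 3%N.

(* Main.v *)
Require Import Defs.
From HB Require Import structures.
From mathcomp Require Import all_boot all_order all_algebra.
From mathcomp Require Import mpoly.
From mathcomp Require Import reals.
From mathcomp Require Import ring lra zify.
Import Order.TTheory GRing.Theory Num.Theory.
Local Open Scope ring_scope.

Set Implicit Arguments.
Unset Strict Implicit.
Unset Printing Implicit Defensive.

(** Soundness reduces to an inverse theorem for the third Gowers norm: expanding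
the acceptance probability one edge at a time, every error term is a correlation
of [f (x + y + z)] with functions of two of the three variables, which three uses
of Cauchy-Schwarz bound by [sum W^2], where [W h xi] is the squared Fourier
coefficient at [xi] of the derivative [x |-> f x * f (x + h)].

For the inverse theorem, [W] is its own symplectic Fourier transform, so it is
positive definite on F_2^n x F_2^n. If [sum W^2] is large, the level set
[S = {W >= t}] has about [2^n] elements and positive definiteness makes many sums
of two elements of [S] land in a lower level set; Balog-Szemeredi-Gowers, Petridis
and Ruzsa's covering argument then give a subgroup of size [O(2^n)] carrying a
positive proportion of [W], hence a matrix [M] whose graph does. Cauchy-Schwarz
shows that [M] is symmetric on a subgroup of bounded index. As [W h xi] vanishes
unless [xi . h = 0], restricting to the subgroup where [z M . z = 0] loses
nothing and makes [M] alternating there, so it is the polarisation of a quadratic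
form, with which [f] must correlate. *)

(** * Finite sums *)

Section Inequalities.
Variable R : realFieldType.

(** Lagrange's identity: the gap is half of the nonnegative double sum of
    [(a i * b j - a j * b i) ^+ 2]. *)
Lemma cauchy_schwarz (I : finType) (P : pred I) (a b : I -> R) :
  (\sum_(i | P i) a i * b i) ^+ 2 <=
  (\sum_(i | P i) a i ^+ 2) * (\sum_(i | P i) b i ^+ 2).
Proof.
have h : 0 <= \sum_(i | P i) \sum_(j | P j) (a i * b j - a j * b i) ^+ 2.
  by apply: sumr_ge0 => i _; apply: sumr_ge0 => j _; apply: sqr_ge0.
have e : \sum_(i | P i) \sum_(j | P j) (a i * b j - a j * b i) ^+ 2 =
  (\sum_(i | P i) a i ^+ 2) * (\sum_(j | P j) b j ^+ 2)
  + (\sum_(i | P i) b i ^+ 2) * (\sum_(j | P j) a j ^+ 2)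
  - 2 * ((\sum_(i | P i) a i * b i) * (\sum_(j | P j) a j * b j)).
  rewrite !big_distrlr mulr_sumr -sumrN -!big_split /=; apply: eq_bigr => i _.
  rewrite mulr_sumr -sumrN -!big_split /=; apply: eq_bigr => j _; ring.
by rewrite e in h; lra.
Qed.

Lemma sqr_sum_le (I : finType) (A : {pred I}) (a : I -> R) :
  (\sum_(i in A) a i) ^+ 2 <= #|A|%:R * \sum_(i in A) a i ^+ 2.
Proof.
have := cauchy_schwarz (mem A) (fun=> 1) a.
rewrite sumr_const expr1n.
by under eq_bigr do rewrite mul1r.
Qed.

Lemma sum_ge0_exists (I : finType) (A : {set I}) (F : I -> R) :
  A != set0 -> 0 <= \sum_(i in A) F i -> exists2 i, i \in A & 0 <= F i.
Proof.
move=> /set0Pn[i0 hi0] h.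
case: (pickP [pred i in A | 0 <= F i]) => [i /andP[hi hF]|none]; first by exists i.
have lt i : i \in A -> F i < 0.
  by move=> hi; have := none i; rewrite /= hi ltNge /= => ->.
suff : \sum_(i in A) F i < 0 by rewrite ltNge h.
rewrite (bigD1 i0) //= -[ltRHS]addr0; apply: ltr_leD; first exact: lt.
by apply: sumr_le0 => i /andP[/lt/ltW].
Qed.

Lemma sum_indicator (I : finType) (A B : {set I}) :
  \sum_(i in A) (i \in B)%:R = #|A :&: B|%:R :> R.
Proof.
rewrite -sum1_card natr_sum big_mkcond [RHS]big_mkcond /=.
by apply: eq_bigr => i _; rewrite inE; case: (i \in A); case: (i \in B).
Qed.

Lemma sum_indicatorT (I : finType) (B : {set I}) :
  \sum_i (i \in B)%:R = #|B|%:R :> R.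
Proof.
by have := sum_indicator [set: I] B; rewrite setTI => <-; apply: eq_bigl => i; rewrite inE.
Qed.

End Inequalities.

(** * Sumsets in groups of exponent two *)

(** Joins the additive and the finite structure of a product, so that subsets of [pt n * pt n] fall
    under the results for a [finZmodType]. *)
HB.instance Definition _ (U V : finZmodType) := GRing.Zmodule.on (U * V)%type.

Section Sumsets.
Variable T : finZmodType.
Implicit Types A B C X : {set T}.

Definition sumset A B : {set T} := [set a + b | a in A, b in B].

Lemma mem_sumset A B a b : a \in A -> b \in B -> a + b \in sumset A B.
Proof. by move=> ha hb; apply/imset2P; exists a b. Qed.

Lemma sumset1 A c : #|sumset A [set c]| = #|A|.
Proof.
rewrite /sumset.
have -> : [set a + b | a in A, b in [set c]] = [set a + c | a in A].
  apply/setP=> x; apply/imset2P/imsetP.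
    by case=> a b ha /set1P -> ->; exists a.
  by case=> a ha ->; exists a c; rewrite ?inE.
by rewrite card_imset //; apply: addIr.
Qed.

Lemma sumsetA A B C : sumset (sumset A B) C = sumset A (sumset B C).
Proof.
apply/setP=> x; apply/imset2P/imset2P.
  case=> y c /imset2P[a b ha hb ->] hc ->; exists a (b + c) => //; last by rewrite addrA.
  exact: mem_sumset.
case=> a y ha /imset2P[b c hb hc ->] ->; exists (a + b) c => //; last by rewrite addrA.
exact: mem_sumset.
Qed.

Lemma sumsetS A B C : A \subset B -> sumset A C \subset sumset B C.
Proof.
by move=> /subsetP s; apply/subsetP=> x /imset2P[a c /s ha hc ->]; apply: mem_sumset.
Qed.

Lemma sumsetUr A B C : sumset A (B :|: C) = sumset A B :|: sumset A C.
Proof.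
apply/setP=> x; apply/imset2P/setUP.
  by case=> a b ha /setUP[] hb ->; [left|right]; apply: mem_sumset.
by case=> /imset2P[a b ha hb ->]; exists a b; rewrite // inE hb ?orbT.
Qed.

Lemma sumsetC A B : sumset A B = sumset B A.
Proof.
by apply/setP=> x; apply/imset2P/imset2P=> -[a b ha hb ->]; exists b a; rewrite // addrC.
Qed.

Lemma leq_card_sumsetl A B : B != set0 -> (#|A| <= #|sumset A B|)%N.
Proof.
case/set0Pn=> b hb; rewrite -(sumset1 A b); apply: subset_leq_card.
apply/subsetP=> x /imset2P[a c ha /set1P -> ->]; exact: mem_sumset.
Qed.

(* The hypothesis says that [X] minimises [#|X + A| / #|X|] among its subsets. *)
Lemma petridis X A C :
  (forall Z : {set T}, Z \subset X -> (#|sumset X A| * #|Z| <= #|sumset Z A| * #|X|)%N) ->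
  (#|sumset (sumset X A) C| * #|X| <= #|sumset X A| * #|sumset X C|)%N.
Proof.
move=> Xmin; have [m] := ubnP #|C|; elim: m C => // m IH C ltCm.
case: (set_0Vmem C) => [->|[c hc]].
  rewrite (_ : sumset _ set0 = set0) ?cards0 ?mul0n //.
  by apply/setP=> x; rewrite inE; apply/imset2P=> -[? ? _]; rewrite inE.
rewrite -(setD1K hc); set C' := C :\ c.
have {IH} IH : (#|sumset (sumset X A) C'| * #|X| <= #|sumset X A| * #|sumset X C'|)%N.
  by apply: IH; move: ltCm; rewrite (cardsD1 c C) hc.
(* [Z] collects the [x] whose translate [x + A + c] brings nothing new to [X + A + C']. *)
pose Z := [set x in X | sumset (sumset [set x] A) [set c] \subset sumset (sumset X A) C'].
have ZX : Z \subset X by apply/subsetP=> x; rewrite inE => /andP[].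
have h1 : (#|sumset (sumset X A) (c |: C')| + #|sumset Z A| <=
           #|sumset (sumset X A) C'| + #|sumset X A|)%N.
  rewrite sumsetUr setUC cardsU -(sumset1 (sumset X A) c) -(sumset1 (sumset Z A) c).
  set P := sumset (sumset X A) C'; set Q := sumset _ [set c].
  have sub : sumset (sumset Z A) [set c] \subset P :&: Q.
    rewrite subsetI; apply/andP; split; last by apply: sumsetS; apply: sumsetS.
    apply/subsetP=> x /imset2P[y d /imset2P[z a hz ha ->] /set1P -> ->].
    move: hz; rewrite inE => /andP[_ /subsetP]; apply.
    by apply: mem_sumset; [apply: mem_sumset|]; rewrite ?inE.
  have := subset_leq_card sub; have := subset_leq_card (subsetIl P Q); lia.
(* A coincidence [x + c = x' + c'] with [c'] in [C'] puts [x + A + c] inside [X + A + C'], hence [x]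
   in [Z]. *)
have h2 : (#|sumset X C'| + #|X| <= #|sumset X (c |: C')| + #|Z|)%N.
  rewrite sumsetUr setUC cardsU.
  set P := sumset X C'; set Q := sumset _ [set c].
  have sub : P :&: Q \subset sumset Z [set c].
    apply/subsetP=> x /setIP[/imset2P[x' c' hx' hc' ->] /imset2P[y d hy /set1P -> e]].
    rewrite e; apply: mem_sumset; rewrite inE // hy.
    apply/subsetP=> u /imset2P[v d' /imset2P[w a /set1P -> ha ->] /set1P -> ->].
    by rewrite addrAC -e addrAC; apply: mem_sumset => //; apply: mem_sumset.
  have := subset_leq_card sub; rewrite sumset1 -(sumset1 X c) -/Q.
  by have := subset_leq_card (subsetIl P Q); lia.
have := Xmin _ ZX; nia.
Qed.

(** Choose [X] inside [A] minimising [#|X + A| / #|X|], a ratio at most [k]. By [petridis] each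
    further summand [A] costs a factor [k], and the fourfold sum of [A] is no larger than its sum
    with [X]. *)
Lemma card_sumset_iter A k : A != set0 -> (#|sumset A A| <= k * #|A|)%N ->
  (#|sumset (sumset A A) (sumset A A)| <= k ^ 4 * #|A|)%N.
Proof.
move=> A0 hk.
pose P (X : {set T}) := (X != set0) && (X \subset A).
have PA : P A by rewrite /P A0 subxx.
pose g (X : {set T}) : rat := #|sumset X A|%:R / #|X|%:R.
case: (Order.TotalTheory.arg_minP g PA) => X /andP[X0 XA] Xm.
have pos (Y : {set T}) : Y != set0 -> (0 < #|Y|%:R :> rat).
  by move=> Y0; rewrite ltr0n card_gt0.
have Xmin (Z : {set T}) : Z \subset X -> (#|sumset X A| * #|Z| <= #|sumset Z A| * #|X|)%N.
  move=> ZX; have [->|Z0] := eqVneq Z set0; first by rewrite cards0 muln0.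
  have := Xm Z; rewrite /P Z0 (subset_trans ZX XA) => /(_ isT).
  by rewrite /g ler_pdivrMr ?pos // mulrAC ler_pdivlMr ?pos // -!natrM ler_nat.
have hX : (#|sumset X A| <= k * #|X|)%N.
  have := Xm A PA; rewrite /g ler_pdivrMr ?pos // mulrAC ler_pdivlMr ?pos //.
  rewrite -!natrM ler_nat => h.
  have A1 : (0 < #|A|)%N by rewrite card_gt0.
  rewrite -(leq_pmul2r A1) (leq_trans h) // mulnAC leq_mul2r hk orbT //.
have X1 : (0 < #|X|)%N by rewrite card_gt0.
have step C j : (#|sumset X C| <= j * #|X|)%N -> (#|sumset X (sumset A C)| <= k * j * #|X|)%N.
  move=> hj; have := petridis (A := A) C Xmin; rewrite -sumsetA => h.
  rewrite -(leq_pmul2r X1); apply: leq_trans h _.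
  by apply: leq_trans (leq_mul hX hj) _; lia.
have h4 := step _ _ (step _ _ (step _ _ hX)).
rewrite sumsetA; set S := sumset A _ in h4 *.
have h5 : (#|S| <= #|sumset X S|)%N.
  by rewrite sumsetC leq_card_sumsetl.
apply: leq_trans h5 _; apply: leq_trans h4 _.
by apply: leq_mul; [rewrite !expnS expn0 muln1 !mulnA | exact: subset_leq_card].
Qed.

Hypothesis T2 : forall x : T, x + x = 0.

(** When [x + x = 0] throughout, elements are their own inverses and this describes subgroups. *)
Definition closed_add (H : {set T}) := 0 \in H /\ {in H &, forall x y, x + y \in H}.

(* Ruzsa covering: a maximal [X] inside [3A] with disjoint translates [x + A] has [#|X| <= k] and [3A] lies in [X + 2A]; hence [<X> + 2A] is stable under adding elements of [A], and we take [H] to be its stabiliser. *)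
Lemma ruzsa_subgroup A k : A != set0 ->
  (#|sumset (sumset A A) (sumset A A)| <= k * #|A|)%N ->
  exists H : {set T}, [/\ closed_add H, A \subset H & (#|H| <= 2 ^ k * k * #|A|)%N].
Proof.
move=> A0 hk; set A2 := sumset A A in hk *.
have hA2 : (#|A2| <= k * #|A|)%N.
  apply: leq_trans hk; apply: leq_card_sumsetl.
  by case/set0Pn: A0 => a ha; apply/set0Pn; exists (a + a); apply: mem_sumset.
pose A3 := sumset A A2.
pose P (X : {set T}) := (X \subset A3) &&
  [forall x in X, forall y in X, (x != y) ==> [disjoint sumset [set x] A & sumset [set y] A]].
have P0 : P set0.
  by rewrite /P sub0set; apply/forallP=> x; rewrite inE.
have [X /maxsetP[/andP[XA Xd] Xmax] _] := maxset_exists P0.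
have Xd' x y a b : x \in X -> y \in X -> a \in A -> b \in A -> x + a = y + b -> x = y.
  move=> hx hy ha hb e; apply/eqP; apply: contraT => ne.
  have /implyP/(_ ne) := implyP (forallP (implyP (forallP Xd x) hx) y) hy.
  rewrite disjoint_subset => /subsetP/(_ (x + a)).
  by rewrite mem_sumset ?inE // => /(_ isT); rewrite e mem_sumset // inE.
have cardXA : #|sumset X A| = (#|X| * #|A|)%N.
  rewrite -cardsX /sumset curry_imset2X card_in_imset //.
  move=> [x a] [y b] /setXP[/= hx ha] /setXP[/= hy hb] /= e.
  have exy := Xd' _ _ _ _ hx hy ha hb e; rewrite exy in e *.
  by rewrite (addrI _ e).
have hX : (#|X| <= k)%N.
  have A1 : (0 < #|A|)%N by rewrite card_gt0.
  rewrite -(leq_pmul2r A1) -cardXA; apply: leq_trans hk.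
  rewrite /A2 sumsetA [X in (_ <= #|pred_of_set X|)%N]sumsetC; apply: subset_leq_card.
  exact: sumsetS.
have cover : A3 \subset sumset X A2.
  apply/subsetP=> u hu; have [uX|uX] := boolP (u \in X).
    case/set0Pn: A0 => a ha; rewrite -[u]addr0 -(T2 a).
    by apply: mem_sumset => //; apply: mem_sumset.
  have : ~~ P (u |: X).
    apply: contra uX => hP; rewrite -(Xmax _ hP) ?setU11 //; exact: subsetUr.
  rewrite /P subUset sub1set hu XA /= negb_forall => /existsP[x].
  rewrite negb_imply => /andP[hx]; rewrite negb_forall => /existsP[y].
  rewrite negb_imply => /andP[hy]; rewrite negb_imply => /andP[ne].
  case/pred0Pn => z /andP[/= /imset2P[x' a /set1P -> ha ->] /imset2P[y' b /set1P -> hb e]].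
  have key w c d : w \in X -> c \in A -> d \in A -> u + c = w + d -> u \in sumset X A2.
    move=> hw hc hd eu; have -> : u = w + (d + c).
      by rewrite addrA -eu -addrA T2 addr0.
    by do 2?apply: mem_sumset.
  move: hx hy; rewrite !inE => /orP[/eqP ex|hx] /orP[/eqP ey|hy].
  - by rewrite ex ey eqxx in ne.
  - by rewrite ex in e; apply: key e.
  - by rewrite ey in e; apply: (key x b a) => //; rewrite e.
  - by have := Xd' _ _ _ _ hx hy ha hb e => exy; rewrite exy eqxx in ne.
(* In exponent two the subset sums of [X] exhaust the group it generates, which therefore has at
   most [2 ^ k] elements. *)
pose SX := [set \sum_(x in Y) x | Y : {set T} in powerset X].
have SX0 : 0 \in SX.
  by apply/imsetP; exists set0; rewrite ?big_set0 // inE sub0set.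
have cardSX : (#|SX| <= 2 ^ k)%N.
  apply: leq_trans (leq_imset_card _ _) _; rewrite card_powerset.
  by rewrite leq_exp2l.
have SXadd x s : x \in X -> s \in SX -> x + s \in SX.
  move=> hx /imsetP[Y]; rewrite inE => YX ->; have [xY|xY] := boolP (x \in Y).
    apply/imsetP; exists (Y :\ x); first by rewrite inE (subset_trans _ YX) ?subD1set.
    by rewrite (big_setD1 x xY) addrA T2 add0r.
  apply/imsetP; exists (x |: Y); first by rewrite inE subUset sub1set hx.
  by rewrite big_setU1.
pose H' := sumset SX A2.
have H'A a h : a \in A -> h \in H' -> h + a \in H'.
  move=> ha /imset2P[s b hs hb ->].
  have : a + b \in A3 by apply: mem_sumset.
  move/(subsetP cover) => /imset2P[x c hx hc e].
  rewrite -addrA [b + a]addrC e addrA [s + x]addrC.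
  by apply: mem_sumset => //; apply: SXadd.
have H'0 : 0 \in H'.
  case/set0Pn: A0 => a ha; rewrite -(T2 a) -[X in X \in _]add0r.
  by apply: mem_sumset => //; apply: mem_sumset.
exists [set v | [forall h in H', h + v \in H']]; split.
- split; first by rewrite inE; apply/forall_inP=> h; rewrite addr0.
  move=> x y; rewrite !inE => /forall_inP hx /forall_inP hy.
  by apply/forall_inP=> h /hx /hy; rewrite addrA.
- by apply/subsetP=> a ha; rewrite inE; apply/forall_inP=> h; apply: H'A.
- apply: (@leq_trans #|H'|).
    apply: subset_leq_card; apply/subsetP=> v; rewrite inE => /forall_inP/(_ _ H'0).
    by rewrite add0r.
  rewrite /H' /sumset curry_imset2X; apply: leq_trans (leq_imset_card _ _) _.
  by rewrite cardsX -mulnA; apply: leq_mul.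
Qed.

End Sumsets.

(** * From positive definite functions to subgroups *)

Section BalogSzemerediGowers.
Variables (R : realFieldType) (T : finZmodType).
Hypothesis T2 : forall x : T, x + x = 0.
Variables (S Q : {set T}).

Let e v w : R := (v + w \in Q)%:R.
Let codeg v v' : R := \sum_(w in S) e v w * e v' w.

(** The number of ways to write [x] as a sum of four elements of [Q]: in exponent two the fourth one
    is [q1 + q2 + q3 + x]. *)
Let rep x : R := \sum_q1 \sum_q2 \sum_q3
  (q1 \in Q)%:R * (q2 \in Q)%:R * (q3 \in Q)%:R * (q1 + q2 + q3 + x \in Q)%:R.

Let sum_rep : \sum_x rep x = #|Q|%:R ^+ 4.
Proof.
rewrite /rep exchange_big /= -(sum_indicatorT R Q) !exprS expr0 mulr1 mulr_suml.
apply: eq_bigr => q1 _; rewrite exchange_big /= mulr_suml mulr_sumr.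
apply: eq_bigr => q2 _; rewrite exchange_big /= mulr_suml !mulr_sumr.
apply: eq_bigr => q3 _; rewrite -mulr_sumr !mulrA; congr (_ * _).
by rewrite [RHS](reindex_inj (addrI (q1 + q2 + q3))).
Qed.

Let rep_ge0 x : 0 <= rep x.
Proof. by do 3![apply: sumr_ge0 => ? _]; rewrite -!natrM ler0n. Qed.

(** A path [v, y, v', z, v''] of the graph writes [v + v''] as [(v + y) + (y + v') + (v' + z) + (z +
    v'')], and the path can be recovered from these four elements of [Q]. *)
Let rep_paths v v'' (A : {set T}) :
  \sum_(v' in A) codeg v v' * codeg v' v'' <= rep (v + v'').
Proof.
rewrite /rep [leRHS](reindex_inj (addrI v)) /=.
under [leRHS]eq_bigr => y _ do rewrite (reindex_inj (addrI y)) /=.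
under [leRHS]eq_bigr => y _ do
  under eq_bigr => v' _ do rewrite (reindex_inj (addrI v')) /=.
rewrite [leRHS]exchange_big /= big_mkcond /=; apply: ler_sum => v' _.
have nn y z : 0 <= (v + y \in Q)%:R * (y + v' \in Q)%:R * (v' + z \in Q)%:R *
    (v + y + (y + v') + (v' + z) + (v + v'') \in Q)%:R :> R.
  by rewrite -!natrM ler0n.
have [_|_] := boolP (v' \in A); last by do 2![apply: sumr_ge0 => ? _].
rewrite /codeg big_distrlr /= big_mkcond /=; apply: ler_sum => y _.
have [_|_] := boolP (y \in S); last by apply: sumr_ge0 => ? _.
rewrite big_mkcond /=; apply: ler_sum => z _.
have [_|_] := boolP (z \in S); last by [].
rewrite /e [v' + y]addrC [v'' + z]addrC mulrA.
suff -> : v + y + (y + v') + (v' + z) + (v + v'') = z + v'' by [].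
rewrite [LHS](AC (2*2*2*2) ((1*7)*(2*3)*(4*5)*(6*8))) /=.
by rewrite !T2 !add0r.
Qed.

(* [A] is the neighbourhood in [S] of a well-chosen [w], for the graph [v + w \in Q]: by averaging, most pairs in [A] have many common neighbours. Keeping the elements of [A] with few bad partners, each sum of two of them has many representations as a sum of four elements of [Q]. *)
Lemma balog_szemeredi_gowers (rho L : R) : S != set0 -> 0 < rho ->
  rho * #|S|%:R ^+ 2 <= \sum_(v in S) \sum_(w in S) (v + w \in Q)%:R ->
  #|Q|%:R <= L * #|S|%:R ->
  exists A : {set T}, [/\ A \subset S, rho / 4 * #|S|%:R <= #|A|%:R &
    rho ^+ 6 * #|sumset A A|%:R <= 4096 * L ^+ 4 * #|A|%:R].
Proof.
move=> S0 rho0 hrho hQ; set s : R := #|S|%:R in hrho hQ *.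
have s0 : 0 < s by rewrite ltr0n card_gt0.
pose kap := rho ^+ 2 / 16.
pose b v v' : R := (codeg v v' < kap * s)%R%:R.
have codegC v v' : codeg v v' = codeg v' v.
  by apply: eq_bigr => w _; rewrite mulrC.
have b01 v v' : 0 <= b v v' <= 1 by rewrite /b ler0n lern1 leq_b1.
pose d w := \sum_(v in S) e v w.
pose B w := \sum_(v in S) \sum_(v' in S) e v w * e v' w * b v v'.
have sumd : rho * s ^+ 2 <= \sum_(w in S) d w by rewrite exchange_big.
have sumd2 : rho ^+ 2 * s ^+ 3 <= \sum_(w in S) d w ^+ 2.
  have h1 := sqr_sum_le S d; rewrite -/s in h1.
  have h2 : (rho * s ^+ 2) ^+ 2 <= (\sum_(w in S) d w) ^+ 2.
    have p0 : 0 <= rho * s ^+ 2 by rewrite mulr_ge0 ?sqr_ge0 // ltW.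
    by rewrite lerXn2r ?nnegrE // (le_trans p0).
  rewrite -(ler_pM2l s0); apply: le_trans h1; apply: le_trans h2.
  by rewrite le_eqVlt; apply/orP; left; apply/eqP; ring.
have sumB : \sum_(w in S) B w <= kap * s ^+ 3.
  rewrite /B exchange_big /=.
  have -> : kap * s ^+ 3 = \sum_(v in S) \sum_(v' in S) kap * s.
    by rewrite !sumr_const -mulrnA -mulr_natr natrM -/s !exprS expr0 mulr1 !mulrA.
  apply: ler_sum => v _; rewrite exchange_big /=; apply: ler_sum => v' _.
  rewrite -mulr_suml -/(codeg v v') /b; case: ltP => h; first by rewrite mulr1 ltW.
  by rewrite mulr0 mulr_ge0 ?ltW // /kap divr_gt0 ?exprn_gt0.
(* As [8 * kap = rho ^+ 2 / 2], subtracting eight times the bad pairs uses up only half of the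
   second moment of the degrees. *)
have [w wS hw] : exists2 w, w \in S & 0 <= d w ^+ 2 - 8 * B w - rho ^+ 2 / 2 * s ^+ 2.
  apply: sum_ge0_exists => //.
  rewrite !sumrB -mulr_sumr sumr_const -[_ *+ #|_|]mulr_natr -/s.
  have e1 : rho ^+ 2 / 2 * s ^+ 2 * s = rho ^+ 2 * s ^+ 3 / 2 by field.
  have e2 : 8 * (kap * s ^+ 3) = rho ^+ 2 * s ^+ 3 / 2 by rewrite /kap; field.
  by rewrite e1; lra.
pose A := [set v in S | v + w \in Q].
set a : R := #|A|%:R.
have sumA (F : T -> R) : \sum_(v in A) F v = \sum_(v in S) e v w * F v.
  rewrite [LHS](eq_bigl (fun v => (v \in S) && (v + w \in Q))).
    rewrite big_mkcondr /=; apply: eq_bigr => v _.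
    by rewrite /e; case: (v + w \in Q); rewrite ?mul1r ?mul0r.
  by move=> v; rewrite inE.
have da : d w = a.
  rewrite /a -sum1_card natr_sum sumA; apply: eq_bigr => v _; by rewrite mulr1.
have Ba : B w = \sum_(v in A) \sum_(v' in A) b v v'.
  rewrite sumA; apply: eq_bigr => v _; rewrite sumA mulr_sumr.
  by apply: eq_bigr => v' _; rewrite mulrA.
have a_ge0 : 0 <= a by rewrite ler0n.
have B_ge0 : 0 <= B w.
  by rewrite Ba; apply: sumr_ge0 => i _; apply: sumr_ge0 => j _; case/andP: (b01 i j).
rewrite da in hw.
have hB : B w <= a ^+ 2 / 8.
  have : 0 <= rho ^+ 2 / 2 * s ^+ 2 by rewrite mulr_ge0 ?divr_ge0 ?sqr_ge0.
  by lra.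
have ha : rho / 2 * s <= a.
  have : (rho / 2 * s) ^+ 2 <= a ^+ 2.
    have : (rho / 2 * s) ^+ 2 = (rho ^+ 2 / 2 * s ^+ 2) / 2 by field.
    have : 0 <= rho ^+ 2 / 2 * s ^+ 2 by rewrite mulr_ge0 ?divr_ge0 ?sqr_ge0.
    by lra.
  by rewrite ler_pXn2r // nnegrE mulr_ge0 ?divr_ge0 // ltW.
have a0 : 0 < a by apply: lt_le_trans ha; rewrite mulr_gt0 // divr_gt0.
pose bd v := \sum_(v' in A) b v v'.
(* At most [a ^+ 2 / 8] ordered pairs in [A] are bad, so at most half of [A] is lost here. *)
pose A' := [set v in A | bd v <= a / 4].
have A'A : A' \subset A by apply/subsetP=> v; rewrite inE => /andP[].
have ha' : a / 2 <= #|A'|%:R.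
  have h1 : #|A :\: A'|%:R * (a / 4) <= B w.
    rewrite Ba -/bd [leRHS](big_setID A') /=.
    have : \sum_(v in A :\: A') a / 4 <= \sum_(v in A :\: A') bd v.
      apply: ler_sum => v; rewrite !inE => /andP[h vA]; move: h.
      by rewrite vA /= -ltNge => /ltW.
    rewrite sumr_const -mulr_natl; set X := \sum_(v in _) bd v.
    have : 0 <= \sum_(v in A :&: A') bd v.
      by apply: sumr_ge0 => i _; apply: sumr_ge0 => j _; case/andP: (b01 i j).
    by rewrite /bd; lra.
  have h2 : #|A|%:R = #|A'|%:R + #|A :\: A'|%:R :> R.
    by rewrite -natrD -(cardsID A' A) (setIidPr A'A).
  have h3 : #|A :\: A'|%:R * (a / 4) <= (a / 2) * (a / 4) by lra.
  rewrite ler_pM2r ?divr_gt0 // in h3.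
  by rewrite -/a in h2; lra.
(* Two elements of [A'] have together at most [a / 2] bad partners; every other [v'] in [A] is the
   midpoint of at least [(kap * s) ^+ 2] paths. *)
have hrep x : x \in sumset A' A' -> a / 2 * (kap * s) ^+ 2 <= rep x.
  case/imset2P=> v v''; rewrite !inE => /andP[vA hv] /andP[v''A hv''] ->.
  apply: le_trans (rep_paths v v'' A).
  have h1 : a / 2 <= \sum_(v' in A) (1 - b v v' - b v'' v').
    by rewrite !sumrB sumr_const -[_ *+ #|_|]mulr_natl mulr1 -/a -/(bd v) -/(bd v''); lra.
  have k0 : 0 <= (kap * s) ^+ 2 by apply: sqr_ge0.
  apply: le_trans (ler_wpM2r k0 h1) _.
  rewrite mulr_suml; apply: ler_sum => v' _; rewrite [codeg v' v'']codegC /b.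
  have cg p q : 0 <= codeg p q.
    by apply: sumr_ge0 => i _; rewrite mulr_ge0.
  have ks : 0 <= kap * s by rewrite mulr_ge0 ?ltW // /kap divr_gt0 ?exprn_gt0.
  have := mulr_ge0 (cg v v') (cg v'' v').
  have [c1|c1] := ltP; have [c2|c2] := ltP; rewrite /= => p0.
  - by apply: le_trans p0; rewrite mulr_le0_ge0 //; lra.
  - by rewrite subrr sub0r oppr0 mul0r.
  - by rewrite subr0 subrr mul0r.
  - by rewrite !subr0 mul1r expr2; apply: ler_pM.
exists A'; split.
- by apply: subset_trans A'A _; apply/subsetP=> v; rewrite inE => /andP[].
- by lra.
- have h1 : #|sumset A' A'|%:R * (a / 2 * (kap * s) ^+ 2) <= (L * s) ^+ 4.
    apply: (@le_trans _ _ (#|Q|%:R ^+ 4)); last by rewrite lerXn2r ?nnegrE ?(le_trans _ hQ).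
    rewrite -sum_rep mulr_natl -sumr_const.
    rewrite [leRHS](bigID (mem (sumset A' A'))) /=.
    rewrite -[leLHS]addr0; apply: lerD; first exact: ler_sum.
    exact: sumr_ge0.
  set x : R := #|sumset A' A'|%:R in h1 *; set a' : R := #|A'|%:R in ha' *.
  have x0 : 0 <= x by rewrite ler0n.
  have h2 : x * (rho / 4 * s * (kap * s) ^+ 2) <= (L * s) ^+ 4.
    apply: le_trans h1; apply: ler_wpM2l => //; apply: ler_wpM2r; first exact: sqr_ge0.
    by lra.
  have e1 : x * (rho / 4 * s * (kap * s) ^+ 2) = x * rho ^+ 5 / 1024 * s ^+ 3.
    by rewrite /kap; field.
  have e2 : (L * s) ^+ 4 = L ^+ 4 * s * s ^+ 3 by ring.
  rewrite e1 e2 ler_pM2r ?exprn_gt0 // in h2.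
  have h3 : rho * (x * rho ^+ 5 / 1024) <= L ^+ 4 * (4 * a').
    apply: (@le_trans _ _ (rho * (L ^+ 4 * s))); first by rewrite ler_pM2l.
    rewrite mulrCA; apply: ler_wpM2l; first by rewrite -[4%N]/(2 * 2)%N exprM sqr_ge0.
    by lra.
  have -> : rho ^+ 6 * x = 1024 * (rho * (x * rho ^+ 5 / 1024)) by field.
  by lra.
Qed.

End BalogSzemerediGowers.

(** * Positive definite functions and their level sets *)

Section PositiveDefinite.
Variables (R : realFieldType) (T : finZmodType) (W : T -> R) (ch : T -> T -> R) (N : R).
Hypotheses (N0 : 0 < N) (W0 : forall v, 0 <= W v) (sumW : \sum_v W v = N).
Hypothesis chD : forall u v w, ch u (v + w) = ch u v * ch u w.
Hypothesis W_fourier : forall v, N * W v = \sum_u W u * ch u v.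

(** Under the weights [W u], of total [N], the function [X u] has mean [m], and its second moment is
    the right-hand side by multiplicativity of [ch u]; the variance is nonnegative. *)
Lemma sum_pd_pairs (S : {set T}) :
  (\sum_(v in S) W v) ^+ 2 <= \sum_(v in S) \sum_(w in S) W (v + w).
Proof.
pose X u := \sum_(v in S) ch u v; set m := \sum_(v in S) W v.
have e1 : \sum_u W u * X u = N * m.
  rewrite mulr_sumr; under [RHS]eq_bigr do rewrite W_fourier.
  by rewrite exchange_big /=; apply: eq_bigr => u _; rewrite mulr_sumr.
have e2 : \sum_u W u * X u ^+ 2 = N * \sum_(v in S) \sum_(w in S) W (v + w).
  rewrite mulr_sumr.
  under [RHS]eq_bigr => v _.
    rewrite mulr_sumr; under eq_bigr => w _ do rewrite W_fourier.
    rewrite exchange_big; over.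
  rewrite exchange_big /=; apply: eq_bigr => u _.
  rewrite expr2 big_distrlr mulr_sumr; apply: eq_bigr => v _.
  by rewrite mulr_sumr; apply: eq_bigr => w _; rewrite chD.
have : 0 <= \sum_u W u * (X u - m) ^+ 2.
  by apply: sumr_ge0 => u _; rewrite mulr_ge0 ?sqr_ge0.
have expand (t : R) : \sum_u W u * (X u - t) ^+ 2 =
    \sum_u W u * X u ^+ 2 - 2 * t * (\sum_u W u * X u) + t ^+ 2 * (\sum_u W u).
  rewrite !mulr_sumr -sumrN -!big_split; apply: eq_bigr => u _ /=; ring.
rewrite expand e1 e2 sumW => h; rewrite -(ler_pM2l N0).
have -> : N * m ^+ 2 = 2 * m * (N * m) - m ^+ 2 * N by ring.
by move: h; lra.
Qed.

Lemma card_level_set (t : R) : 0 < t -> #|[set v | t <= W v]|%:R <= N / t.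
Proof.
move=> t0; rewrite ler_pdivlMr // -sumW mulr_natl -sumr_const.
rewrite [leRHS](bigID (mem [set v | t <= W v])) /= -[leLHS]addr0.
apply: lerD; last by apply: sumr_ge0 => v _.
by apply: ler_sum => v; rewrite inE.
Qed.

End PositiveDefinite.

Lemma pd_subgroup (R : archiRealFieldType) (a : R) : 0 < a ->
  exists C c : R, [/\ 0 < C, 0 < c &
  forall (T : finZmodType) (W : T -> R) (ch : T -> T -> R) (N : R),
    (forall x : T, x + x = 0) -> 0 < N -> (forall v, 0 <= W v <= 1) -> \sum_v W v = N ->
    (forall u v w, ch u (v + w) = ch u v * ch u w) ->
    (forall v, N * W v = \sum_u W u * ch u v) ->
    a * N <= \sum_v W v ^+ 2 ->
  exists H : {set T}, [/\ closed_add H, #|H|%:R <= C * N & c * N <= \sum_(v in H) W v]].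
Proof.
(* Points with [W v < b] contribute at most [b * N], half of the hypothesis, to the sum of squares.
   Pairs with [W (v + w) < rho] account for at most half of the [(b * s) ^+ 2] supplied by
   [sum_pd_pairs]. *)
move=> a0; pose b := a / 2; pose rho := b ^+ 2 / 2.
have b0 : 0 < b by rewrite divr_gt0.
have rho0 : 0 < rho by rewrite divr_gt0 ?exprn_gt0.
pose L := (rho * b)^-1; pose k := Num.bound (4096 * L ^+ 4 / rho ^+ 6).
(* The exponent in [k ^ 4] comes from [card_sumset_iter]; the successor keeps the constant positive
   even when [k] is zero. *)
exists ((2 ^ (k ^ 4) * k ^ 4)%N.+1%:R / b), (b * (rho / 4 * b)); split.
- by rewrite divr_gt0 ?ltr0n.
- by rewrite !mulr_gt0 ?invr_gt0.
move=> T W ch N T2 N0 W01 sumW chD WF hW.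
have W0 v : 0 <= W v by case/andP: (W01 v).
have W1 v : W v <= 1 by case/andP: (W01 v).
pose S := [set v | b <= W v]; pose Q := [set v | rho <= W v].
have hS1 : b * N <= \sum_(v in S) W v.
  have h : \sum_v W v ^+ 2 <= \sum_(v in S) W v + b * N.
    rewrite (bigID (mem S)) /= -sumW mulr_sumr; apply: lerD.
      by apply: ler_sum => v _; rewrite expr2 -[leRHS]mul1r ler_wpM2r.
    rewrite [leRHS](bigID (mem S)) /= -[leLHS]add0r; apply: lerD.
      by apply: sumr_ge0 => v _; rewrite mulr_ge0 // ltW.
    by apply: ler_sum => v; rewrite inE -ltNge => /ltW h; rewrite expr2 ler_wpM2r.
  have : a * N = b * N + b * N by rewrite /b; field.
  by lra.
have hS2 : b * N <= #|S|%:R.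
  by apply: le_trans hS1 _; rewrite -sum1_card natr_sum; apply: ler_sum => v _.
have S0 : S != set0.
  by rewrite -card_gt0 -(ltr0n R); apply: lt_le_trans hS2; rewrite mulr_gt0.
set s : R := #|S|%:R in hS2 *.
have s1 : 0 < s by rewrite ltr0n card_gt0.
have s0 : 0 <= s by apply: ltW.
have hS3 : s <= N / b := card_level_set W0 sumW b0.
have hQ : #|Q|%:R <= L * s.
  apply: le_trans (card_level_set W0 sumW rho0) _.
  have -> : N / rho = L * (b * N) by rewrite /L; field; rewrite !gt_eqF.
  by rewrite ler_pM2l // invr_gt0 mulr_gt0.
have hpairs : rho * s ^+ 2 <= \sum_(v in S) \sum_(w in S) (v + w \in Q)%:R.
  have h1 := sum_pd_pairs N0 W0 sumW chD WF S.
  have h2 : (b * s) ^+ 2 <= (\sum_(v in S) W v) ^+ 2.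
    have h : b * s <= \sum_(v in S) W v.
      by rewrite /s mulrC mulr_natl -sumr_const; apply: ler_sum => v; rewrite inE.
    have h' : 0 <= b * s by rewrite mulr_ge0 // ltW.
    by rewrite lerXn2r ?nnegrE ?(le_trans h' h).
  have h3 : \sum_(v in S) \sum_(w in S) W (v + w) <=
      \sum_(v in S) \sum_(w in S) (v + w \in Q)%:R + rho * s ^+ 2.
    have -> : rho * s ^+ 2 = \sum_(v in S) \sum_(w in S) rho.
      by rewrite !sumr_const -mulrnA -[RHS]mulr_natr natrM -/s expr2.
    rewrite -big_split /=; apply: ler_sum => v _; rewrite -big_split /=.
    apply: ler_sum => w _; rewrite inE; case: (leP rho (W (v + w))) => h /=.
      by apply: le_trans (W1 _) _; rewrite lerDl ltW.
    by rewrite add0r ltW.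
  have : (b * s) ^+ 2 = rho * s ^+ 2 + rho * s ^+ 2 by rewrite /rho; field.
  by lra.
have [A [AS hA hAA]] := balog_szemeredi_gowers T2 S0 rho0 hpairs hQ.
rewrite -/s in hA.
have A0 : A != set0.
  rewrite -card_gt0 -(ltr0n R); apply: lt_le_trans hA.
  by rewrite mulr_gt0 // divr_gt0.
have hk : (#|sumset A A| <= k * #|A|)%N.
  rewrite -(ler_nat R) natrM.
  have h : 4096 * L ^+ 4 / rho ^+ 6 <= k%:R.
    apply: ltW; apply: archi_boundP.
    have L0 : 0 <= L by rewrite invr_ge0 mulr_ge0 // ltW.
    by apply: divr_ge0; [apply: mulr_ge0 => // | ]; apply: exprn_ge0 => //; apply: ltW.
  apply: le_trans (ler_wpM2r (ler0n _ _) h).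
  by rewrite mulrAC ler_pdivlMr ?exprn_gt0 // mulrC.
have [H [Hc AH hH]] := ruzsa_subgroup T2 A0 (card_sumset_iter A0 hk).
exists H; split=> //.
- apply: (@le_trans _ _ ((2 ^ (k ^ 4) * k ^ 4)%:R * s)).
    by rewrite -natrM ler_nat; apply: leq_trans hH _; rewrite leq_mul2l subset_leq_card ?orbT.
  rewrite -[leRHS]mulrA [b^-1 * N]mulrC; apply: ler_pM => //.
  by rewrite ler_nat leqnSn.
- apply: (@le_trans _ _ (\sum_(v in A) W v)).
    have h : b * #|A|%:R <= \sum_(v in A) W v.
      rewrite mulrC mulr_natl -sumr_const; apply: ler_sum => v /(subsetP AS).
      by rewrite inE.
    apply: le_trans h; rewrite -mulrA ler_pM2l //; apply: le_trans hA.
    by rewrite -mulrA ler_pM2l // divr_gt0.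
  rewrite [leRHS](big_setID A) /= (setIidPr AH) lerDl.
  exact: sumr_ge0.
Qed.

(** * The squared spectrum of derivatives *)

Section Characters.
Variable R : realFieldType.
Variable n : nat.
Implicit Types x y z : pt n.

Lemma F2_cases (b : 'F_2) : b = 0 \/ b = 1.
Proof. by case: b => [[|[|m]] hm] //; [left|right]; apply: val_inj. Qed.

Lemma F2_addbb (b : 'F_2) : b + b = 0.
Proof. by case: (F2_cases b) => ->; apply: val_inj. Qed.

Lemma mx2 m k (A : 'M['F_2]_(m, k)) : A + A = 0.
Proof. by apply/matrixP=> i j; rewrite !mxE F2_addbb. Qed.

Lemma mx_addNl m k (A B : 'M['F_2]_(m, k)) : A + B = 0 -> A = B.
Proof. by move=> e; rewrite -[A]addr0 -(mx2 B) addrA e add0r. Qed.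

Lemma sgnF2D (a b : 'F_2) : sgnF2 R (a + b) = sgnF2 R a * sgnF2 R b.
Proof.
case: (F2_cases a) => ->; case: (F2_cases b) => ->;
  by rewrite /sgnF2 ?addr0 ?add0r ?F2_addbb ?eqxx ?mul1r ?mulr1 ?mulrNN ?mulr1.
Qed.

Lemma sgnF20 : sgnF2 R 0 = 1. Proof. by rewrite /sgnF2 eqxx. Qed.

Lemma sgnF2_sqr (a : 'F_2) : sgnF2 R a * sgnF2 R a = 1.
Proof. by rewrite -sgnF2D F2_addbb sgnF20. Qed.

Lemma sgnF2_le1 (a : 'F_2) : sgnF2 R a <= 1.
Proof. by rewrite /sgnF2; case: ifP => _ //; lra. Qed.

Definition dot x y : 'F_2 := (x *m y^T) ord0 ord0.

Lemma dotC x y : dot x y = dot y x.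
Proof. by rewrite /dot !mxE; apply: eq_bigr => i _; rewrite !mxE mulrC. Qed.

Lemma dotDl x y z : dot (x + y) z = dot x z + dot y z.
Proof. by rewrite /dot mulmxDl mxE. Qed.

Lemma dotDr x y z : dot x (y + z) = dot x y + dot x z.
Proof. by rewrite dotC dotDl !(dotC x). Qed.

Lemma dot0r x : dot x 0 = 0.
Proof. by rewrite /dot trmx0 mulmx0 mxE. Qed.

Lemma dot_mulmx x y (M : 'M_n) : dot x (y *m M) = dot (x *m M^T) y.
Proof. by rewrite /dot trmx_mul mulmxA. Qed.

Definition chi x y : R := sgnF2 R (dot x y).

Lemma chiC x y : chi x y = chi y x. Proof. by rewrite /chi dotC. Qed.
Lemma chiDl x y z : chi (x + y) z = chi x z * chi y z.
Proof. by rewrite /chi dotDl sgnF2D. Qed.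
Lemma chiDr x y z : chi x (y + z) = chi x y * chi x z.
Proof. by rewrite /chi dotDr sgnF2D. Qed.
Lemma chi0r x : chi x 0 = 1. Proof. by rewrite /chi dot0r sgnF20. Qed.
Lemma chi_sqr x y : chi x y * chi x y = 1. Proof. exact: sgnF2_sqr. Qed.
Lemma chi_mulmx x y (M : 'M_n) : chi x (y *m M) = chi (x *m M^T) y.
Proof. by rewrite /chi dot_mulmx. Qed.

Definition npts : R := #|{: pt n}|%:R.

Lemma npts_gt0 : 0 < npts.
Proof. by rewrite ltr0n; apply/card_gt0P; exists 0. Qed.

Lemma sum1_npts : \sum_(x : pt n) 1 = npts.
Proof. by rewrite sumr_const. Qed.

Lemma sum_shift (F : pt n -> R) z : \sum_x F (x + z) = \sum_x F x.
Proof. by rewrite [RHS](reindex_inj (addIr z)). Qed.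

(** If [c z] differs from 1 for some [z] in [H], translating by [z] multiplies the sum by [c z], so
    it vanishes. *)
Lemma sum_char_subgroup (T : finZmodType) (H : {set T}) (c : T -> R) :
  (forall x : T, x + x = 0) -> closed_add H ->
  (forall u v, c (u + v) = c u * c v) -> (forall u, c u * c u = 1) ->
  \sum_(x in H) c x = if [forall x in H, c x == 1] then #|H|%:R else 0.
Proof.
move=> T2 [H0 HD] cD c2; case: ifP => [/forall_inP h|].
  by rewrite -sum1_card natr_sum; apply: eq_bigr => x /h/eqP.
move/negbT; rewrite negb_forall => /existsP[z]; rewrite negb_imply => /andP[zH cz].
have e : \sum_(x in H) c x = c z * \sum_(x in H) c x.
  rewrite [LHS](reindex_inj (addrI z)) mulr_sumr /=; apply: eq_big => x.
    apply/idP/idP => hx; last exact: HD.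
    by rewrite -[x]add0r -(T2 z) -addrA; apply: HD.
  by rewrite cD.
have e' : (c z - 1) * \sum_(x in H) c x = 0 by rewrite mulrBl mul1r -e subrr.
by move/eqP: e'; rewrite mulf_eq0 subr_eq0 (negbTE cz) => /eqP.
Qed.

Lemma sum_chi x : \sum_y chi x y = if x == 0 then npts else 0.
Proof.
have h : \sum_y chi x y = \sum_(y in [set: pt n]) chi x y.
  by apply: eq_bigl => y; rewrite inE.
rewrite h sum_char_subgroup.
- rewrite cardsT; congr (if _ then _ else _); apply/forall_inP/eqP => [hx|-> y _].
    apply/matrixP=> i j; rewrite (ord1 i) mxE; apply/eqP.
    have := hx (delta_mx 0 j); rewrite inE => /(_ isT); rewrite /chi /dot.
    rewrite trmx_delta -colE mxE /sgnF2; case: ifP => // _ /eqP e.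
    by exfalso; lra.
  by rewrite chiC chi0r.
- exact: mx2.
- by split=> [|y z _ _]; rewrite inE.
- exact: chiDr.
- exact: chi_sqr.
Qed.

End Characters.

Section SquaredSpectrum.
Variables (R : realFieldType) (n : nat) (f : pt n -> R).
Hypothesis f2 : forall x, f x * f x = 1.
Local Notation N := (npts R n).
Local Notation chi := (chi R).

Definition W (h xi : pt n) : R := (N^-1 * \sum_x f x * f (x + h) * chi xi x) ^+ 2.

Lemma W_expand h xi : N ^+ 2 * W h xi =
  \sum_x \sum_y f x * f (x + h) * (f y * f (y + h)) * chi xi (x + y).
Proof.
rewrite /W exprMn mulrA exprVn mulfV ?mul1r; last by rewrite expf_neq0 // gt_eqF // npts_gt0.
rewrite expr2 big_distrlr /=; apply: eq_bigr => x _; apply: eq_bigr => y _.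
by rewrite chiDr; ring.
Qed.

Lemma W_ge0 h xi : 0 <= W h xi. Proof. exact: sqr_ge0. Qed.

Lemma W_le1 h xi : W h xi <= 1.
Proof.
rewrite /W exprMn exprVn ler_pdivrMl ?exprn_gt0 ?npts_gt0 // mulr1.
have := sqr_sum_le (mem {: pt n}) (fun x => f x * f (x + h) * chi xi x).
have -> : \sum_(x in {: pt n}) (f x * f (x + h) * chi xi x) ^+ 2 = N.
  rewrite -sum1_npts; apply: eq_bigr => x _.
  by rewrite expr2 mulrACA chi_sqr mulrACA !f2 !mulr1.
by rewrite -/N -expr2.
Qed.

(** Summing over [xi] leaves only the pairs with [y = x + k]. What remains is a product of [f] over
    the parallelogram [x, x + h, x + k, x + k + h], which is symmetric in [h] and [k] and can be
    read as a correlation of derivatives along [k]. *)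
Lemma W_fourier k eta :
  N * W k eta = \sum_h \sum_xi W h xi * (chi h eta * chi xi k).
Proof.
have N2 : N ^+ 2 != 0 by rewrite expf_neq0 // gt_eqF // npts_gt0.
apply: (mulfI N2); rewrite mulrCA W_expand [RHS]mulr_sumr.
have inner h : N ^+ 2 * (\sum_xi W h xi * (chi h eta * chi xi k)) =
   N * \sum_x f x * f (x + h) * (f (x + k) * f (x + k + h)) * chi h eta.
  rewrite mulr_sumr.
  under eq_bigr => xi _ do rewrite mulrA W_expand mulr_suml.
  rewrite exchange_big mulr_sumr; apply: eq_bigr => x _ /=.
  under eq_bigr => xi _ do rewrite mulr_suml.
  rewrite exchange_big /= (bigD1 (x + k)) //= [X in _ + X]big1 ?addr0.
    rewrite addrA mx2 add0r; under eq_bigr => xi _.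
      rewrite (_ : _ * _ = f x * f (x + h) * (f (x + k) * f (x + k + h)) * chi h eta).
      over.
      by rewrite -mulrA [chi h eta * _]mulrC [chi xi k * _]mulrA chi_sqr mul1r.
    by rewrite sumr_const mulr_natl.
  move=> y ne; under eq_bigr => xi _.
    rewrite (_ : _ * _ = f x * f (x + h) * (f y * f (y + h)) * chi h eta * chi (x + y + k) xi).
    over.
    by rewrite ![chi (_ + _) _]chiC chiDr; ring.
  rewrite -mulr_sumr sum_chi; case: eqP => [e|]; last by rewrite mulr0.
  by case/eqP: ne; apply: mx_addNl; rewrite -e addrA [y + x]addrC.
under [RHS]eq_bigr => h _ do rewrite inner.
rewrite -mulr_sumr; congr (_ * _); rewrite [RHS]exchange_big /=; apply: eq_bigr => x _.
rewrite [RHS](reindex_inj (addrI x)); apply: eq_bigr => y _ /=.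
have -> : x + k + (x + y) = y + k by rewrite [LHS](AC (2*2) ((1*3)*(4*2))) /= mx2 add0r.
rewrite addrA mx2 add0r.
by rewrite [chi eta _]chiC; ring.
Qed.

Lemma W00 : W 0 0 = 1.
Proof.
rewrite /W (eq_bigr (fun=> 1)) => [|x _].
  by rewrite sum1_npts mulVf ?expr1n // gt_eqF // npts_gt0.
by rewrite addr0 f2 chiC chi0r mulr1.
Qed.

Lemma sum_W : \sum_h \sum_xi W h xi = N.
Proof.
rewrite -[RHS]mulr1 -W00 W_fourier.
by apply: eq_bigr => h _; apply: eq_bigr => xi _; rewrite !chi0r !mulr1.
Qed.

(** Parseval's identity for [x |-> f x * f (x + h)], whose square is one. *)
Lemma sum_W_row h : \sum_xi W h xi = 1.
Proof.
have N2 : N ^+ 2 != 0 by rewrite expf_neq0 // gt_eqF // npts_gt0.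
apply: (mulfI N2); rewrite mulr_sumr; under eq_bigr do rewrite W_expand.
rewrite exchange_big mulr1 expr2 /=.
have -> : N * N = \sum_(x : pt n) N by rewrite sumr_const mulr_natl.
apply: eq_bigr => x _; rewrite exchange_big /= (bigD1 x) //= [X in _ + X]big1 ?addr0.
  rewrite mx2 (eq_bigr (fun=> 1)) ?sum1_npts // => xi _.
  by rewrite chi0r mulr1 mulrACA !f2 mulr1.
move=> y ne; rewrite -mulr_sumr; under eq_bigr do rewrite chiC.
rewrite sum_chi; case: eqP => [/mx_addNl e|]; last by rewrite mulr0.
by rewrite e eqxx in ne.
Qed.

(* Translating [x] by [h] multiplies the defining sum by [chi xi h]. *)
Lemma W_isotropic h xi : W h xi != 0 -> dot xi h = 0.
Proof.
case: (F2_cases (dot xi h)) => // e; case/eqP.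
rewrite /W; set S := \sum_x _; suff -> : S = 0 by rewrite mulr0 expr0n.
have : S = - S.
  rewrite {1}/S -(sum_shift _ h) -sumrN; apply: eq_bigr => x _.
  rewrite -addrA mx2 addr0 chiDr.
  have -> : chi xi h = -1 by rewrite -[LHS]/(sgnF2 R (dot xi h)) e.
  by rewrite mulrN1 mulrN [f (x + h) * _]mulrC.
by move=> h2; lra.
Qed.

(** Poisson summation: for the symplectic pairing, the annihilator of the graph of [M] is the graph
    of [M^T], and the translation by [k] becomes the twist [chi h k]. *)
Lemma sum_W_graph (M : 'M_n) k :
  \sum_h W h (h *m M + k) = \sum_h W h (h *m M^T) * chi h k.
Proof.
have N1 : N != 0 by rewrite gt_eqF // npts_gt0.
apply: (mulfI N1); rewrite !mulr_sumr.
under eq_bigr do rewrite W_fourier.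
rewrite exchange_big; apply: eq_bigr => h _ /=.
rewrite exchange_big /= (bigD1 (h *m M^T)) //= [X in _ + X]big1 ?addr0.
  under eq_bigr => z _.
    rewrite (_ : _ * _ = W h (h *m M^T) * chi h k); first over.
    by rewrite chiDr chi_mulmx [_ * chi h k * _]mulrAC chi_sqr mul1r.
  by rewrite sumr_const mulr_natl.
move=> xi ne; under eq_bigr => z _.
  rewrite (_ : _ * _ = W h xi * chi h k * chi (h *m M^T + xi) z); first over.
  by rewrite chiDr chi_mulmx chiDl; ring.
rewrite -mulr_sumr sum_chi; case: eqP => [/mx_addNl e|]; last by rewrite mulr0.
by rewrite e eqxx in ne.
Qed.

(** On the Fourier side all terms are nonnegative when [k = 0], and a sign twist can only lower
    them. *)
Lemma sum_W_graph_le (M : 'M_n) k :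
  \sum_h W h (h *m M + k) <= \sum_h W h (h *m M).
Proof.
have -> : \sum_h W h (h *m M) = \sum_h W h (h *m M + 0).
  by apply: eq_bigr => h _; rewrite addr0.
rewrite !sum_W_graph; apply: ler_sum => h _; rewrite chi0r mulr1.
by rewrite -[leRHS]mulr1 ler_wpM2l ?W_ge0 ?sgnF2_le1.
Qed.

End SquaredSpectrum.

(** * The inverse theorem *)

Lemma pairD (U V : zmodType) (a c : U) (b d : V) : (a, b) + (c, d) = (a + c, b + d).
Proof. by []. Qed.

(** List the elements of [H] as rows, first components in [D] and second ones in [X]. The
    pseudo-inverse of [D] writes [h] linearly as a combination of rows of [D], and the same
    combination of rows of [X] lies above [h]. *)
Lemma subgroup_section n (H : {set pt n * pt n}) : closed_add H ->
  exists M : 'M['F_2]_n, forall h xi, (h, xi) \in H -> (h, h *m M) \in H.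
Proof.
case=> H0 HD.
pose D : 'M['F_2]_(#|H|, n) := \matrix_(i, j) (enum_val i : pt n * pt n).1 ord0 j.
pose X : 'M['F_2]_(#|H|, n) := \matrix_(i, j) (enum_val i : pt n * pt n).2 ord0 j.
have rD i : row i D = (enum_val i : pt n * pt n).1 by apply/matrixP=> u j; rewrite !mxE (ord1 u).
have rX i : row i X = (enum_val i : pt n * pt n).2 by apply/matrixP=> u j; rewrite !mxE (ord1 u).
have comb (c : 'rV_#|H|) : (c *m D, c *m X) \in H.
  rewrite !mulmx_sum_row.
  elim/big_ind2: _ => [//|x1 x2 y1 y2 h1 h2|i _]; first exact: HD _ _ h1 h2.
  rewrite rD rX; case: (F2_cases (c 0 i)) => ->; first by rewrite !scale0r.
  by rewrite !scale1r -surjective_pairing enum_valP.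
exists (pinvmx D *m X) => h xi hH; have := comb (h *m pinvmx D).
rewrite mulmxKpV ?mulmxA //.
have -> : h = row (enum_rank_in hH (h, xi)) D by rewrite rD enum_rankK_in.
exact: row_sub.
Qed.

(** The pseudo-inverse of a matrix whose rows list [Z] yields a linear projection onto [Z] without
    choosing a basis. *)
Lemma subgroup_projection n (Z : {set pt n}) : closed_add Z ->
  exists P : 'M['F_2]_n, (forall h, h *m P \in Z) /\ {in Z, forall z, z *m P = z}.
Proof.
case=> Z0 ZD.
pose D : 'M['F_2]_(#|Z|, n) := \matrix_(i, j) (enum_val i : pt n) ord0 j.
have rD i : row i D = enum_val i by apply/matrixP=> u j; rewrite !mxE (ord1 u).
exists (pinvmx D *m D); split=> [h|z hz].
  rewrite mulmxA mulmx_sum_row; elim/big_ind: _ => [//|x y hx hy|i _]; first exact: ZD.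
  rewrite rD; case: (F2_cases ((h *m pinvmx D) 0 i)) => ->; first by rewrite scale0r.
  by rewrite scale1r enum_valP.
rewrite mulmxA mulmxKpV //.
have -> : z = row (enum_rank_in hz z) D by rewrite rD enum_rankK_in.
exact: row_sub.
Qed.

(** * Concentration of the squared spectrum on the graph of a linear map *)

Section Linearisation.
Variables (R : realFieldType) (n : nat) (f : pt n -> R).
Hypothesis f2 : forall x, f x * f x = 1.
Local Notation N := (npts R n).
Local Notation chi := (chi R).
Local Notation W := (W f).

(** [H] is the union over [k] in the vertical fibre [K] of translates of the graph above its
    projection [D]. Rows of [W] have mass one, so [D] has at least [c * N] elements; each translate
    carries at most [s], so the mass of [H] is at most [#|K| * s]. Multiplying the two bounds and
    using [#|D| * #|K| <= C * N] gives the claim. *)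
Lemma graph_of_subgroup (H : {set pt n * pt n}) (C c : R) : 
  closed_add H -> 0 < C -> 0 < c -> #|H|%:R <= C * N ->
  c * N <= \sum_(v in H) W v.1 v.2 ->
  exists M : 'M_n, c ^+ 2 / C * N <= \sum_h W h (h *m M).
Proof.
move=> Hc C0 c0 hC hc; have [M hM] := subgroup_section Hc; case: Hc => H0 HD.
exists M; set s := \sum_h W h (h *m M).
have N0 := npts_gt0 R n.
pose D := [set v.1 | v in H]; pose K := [set k | (0, k) \in H].
have hD h : h \in D -> (h, h *m M) \in H.
  by case/imsetP=> -[h' xi] hv /= ->; apply: hM hv.
have Kin h k : (h, h *m M + k) \in H -> k \in K.
  move=> hk; rewrite inE; have := HD _ _ (hM _ _ hk) hk.
  by rewrite pairD addrA !mx2 add0r.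
have cDK : (#|D| * #|K| <= #|H|)%N.
  pose g (p : pt n * pt n) := (p.1, p.1 *m M + p.2).
  have inj : injective g by move=> [x y] [x' y'] /= [-> /addrI ->].
  rewrite -cardsX -(card_imset _ inj); apply: subset_leq_card.
  apply/subsetP=> _ /imsetP[[h k] /setXP[/= hh hk] ->].
  have := HD _ _ (hD _ hh); rewrite inE in hk; move/(_ _ hk).
  by rewrite pairD addr0.
have hcD : c * N <= #|D|%:R.
  apply: le_trans hc _; rewrite -sum1_card natr_sum.
  rewrite (eq_bigr (fun h => \sum_xi W h xi)) => [|h _]; last by rewrite sum_W_row.
  rewrite pair_big_dep /=; rewrite [leRHS](bigID (mem H)) /= -[leLHS]addr0.
  apply: lerD; last by apply: sumr_ge0 => v _; apply: W_ge0.
  rewrite le_eqVlt; apply/orP; left; apply/eqP; apply: eq_bigl => v.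
  case hv: (v \in H); last by rewrite andbF.
  by rewrite !andbT; apply/esym/imsetP; exists v.
have hs : \sum_(v in H) W v.1 v.2 <= #|K|%:R * s.
  rewrite mulr_natl -sumr_const.
  apply: (@le_trans _ _ (\sum_(k in K) \sum_h W h (h *m M + k))).
    have -> : \sum_(v in H) W v.1 v.2 = \sum_h \sum_xi if (h, xi) \in H then W h xi else 0.
      by rewrite pair_bigA big_mkcond; apply: eq_bigr => -[].
    rewrite [leRHS]exchange_big /=.
    apply: ler_sum => h _; rewrite [leLHS](reindex_inj (addrI (h *m M))) [leRHS]big_mkcond /=.
    apply: ler_sum => k _; case: ifP => [/Kin ->//|_]; case: ifP => // _; exact: W_ge0.
  by apply: ler_sum => k _; apply: sum_W_graph_le.
have s0 : 0 <= s by apply: sumr_ge0 => h _; apply: W_ge0.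
have hDK : #|D|%:R * #|K|%:R <= C * N by apply: le_trans hC; rewrite -natrM ler_nat.
have h1 : c * N * (c * N) <= C * N * s.
  apply: (@le_trans _ _ (#|D|%:R * (#|K|%:R * s))).
    have cN0 : 0 <= c * N by apply: mulr_ge0; apply: ltW.
    by apply: ler_pM => //; apply: le_trans hs.
  by rewrite mulrA; apply: ler_wpM2r.
have h2 : c * (c * N) <= C * s by rewrite -(ler_pM2l N0); move: h1; lra.
by rewrite mulrAC ler_pdivrMr // expr2 -mulrA [leRHS]mulrC.
Qed.

Definition sym_kernel (M : 'M['F_2]_n) := [set h : pt n | h *m M == h *m M^T].

Lemma sq1_le1 (x : R) : x * x = 1 -> x <= 1.
Proof. by move=> e; rewrite leNgt; apply/negP=> h; nra. Qed.

(* Writing the sum of [W] over the graph as an average of [f x * f z * G x z] and applying Cauchy-Schwarz, the phase that survives is linear in [x] with coefficient [(a + b) *m (M + M^T)]. *)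
Lemma card_sym_kernel (M : 'M['F_2]_n) :
  (\sum_h W h (h *m M)) ^+ 2 <= N * #|sym_kernel M|%:R.
Proof.
set s := \sum_h _; have N0 := npts_gt0 R n.
pose G (p : pt n * pt n) :=
  \sum_h f (p.1 + h) * f (p.2 + h) * chi (h *m M) (p.1 + p.2 + h).
have e1 : N ^+ 2 * s = \sum_(p : pt n * pt n) (f p.1 * f p.2) * G p.
  rewrite mulr_sumr; under eq_bigr => h _ do rewrite W_expand.
  under [RHS]eq_bigr do rewrite mulr_sumr.
  rewrite [RHS]exchange_big /=; apply: eq_bigr => h _.
  rewrite -(pair_bigA _ (fun x z =>
    f x * f z * (f (x + h) * f (z + h) * chi (h *m M) (x + z + h)))) /=.
  apply: eq_bigr => x _; rewrite (reindex_inj (addIr h)); apply: eq_bigr => z _ /=.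
  by rewrite -addrA mx2 addr0 addrA; ring.
have cs := cauchy_schwarz predT (fun p : pt n * pt n => f p.1 * f p.2) G.
rewrite -e1 in cs.
have e2 : \sum_(p : pt n * pt n) (f p.1 * f p.2) ^+ 2 = N ^+ 2.
  rewrite (eq_bigr (fun=> 1)) => [|p _]; last by rewrite expr2 mulrACA !f2 mulr1.
  by rewrite sumr_const card_prod natrM expr2.
(* Replacing [a], [b], [z] by [x + a], [x + b], [x + a + c] frees all values of [f] from [x]. *)
have e3 : \sum_p G p ^+ 2 = \sum_a \sum_b \sum_c
   f a * f b * f c * f (a + b + c) * (chi (a *m M) c * chi (b *m M) (a + b + c))
   * \sum_x chi ((a + b) *m (M + M^T)) x.
  rewrite -(pair_bigA _ (fun x z => G (x, z) ^+ 2)) /=.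
  under [RHS]eq_bigr => a _.
    under eq_bigr => b _.
      under eq_bigr do rewrite mulr_sumr.
      rewrite exchange_big; over.
    rewrite exchange_big; over.
  rewrite [RHS]exchange_big /=; apply: eq_bigr => x _.
  under [LHS]eq_bigr => z _ do rewrite /G expr2 big_distrlr /=.
  rewrite exchange_big (reindex_inj (addrI x)); apply: eq_bigr => a _ /=.
  rewrite exchange_big (reindex_inj (addrI x)); apply: eq_bigr => b _ /=.
  rewrite (reindex_inj (addrI (x + a))); apply: eq_bigr => c _ /=.
  have -> : x + (x + a) = a by rewrite addrA mx2 add0r.
  have -> : x + (x + b) = b by rewrite addrA mx2 add0r.
  have -> : x + a + c + (x + a) = c.
    by rewrite [LHS](AC (3*2) ((1*4)*(2*5)*3)) /= !mx2 !add0r.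
  have -> : x + a + c + (x + b) = a + b + c.
    by rewrite [LHS](AC (3*2) ((1*4)*(2*5*3))) /= !mx2 !add0r.
  have -> : x + (x + a + c) + (x + a) = x + c.
    by rewrite [LHS](AC ((1*3)*2) ((1*2)*(3*6)*(5*4))) /= !mx2 !add0r.
  have -> : x + (x + a + c) + (x + b) = x + (a + b + c).
    by rewrite [LHS](AC ((1*3)*2) ((1*2)*(5*(3*6*4)))) /= !mx2 !add0r.
  have -> : chi ((a + b) *m (M + M^T)) x =
      chi (a *m M) x * chi (b *m M) x * (chi (x *m M) a * chi (x *m M) b).
    rewrite mulmxDr chiDl mulmxDl chiDl; congr (_ * _).
    by rewrite -chi_mulmx chiC chiDr.
  rewrite !mulmxDl !chiDl !chiDr.
  have := chi_sqr R (x *m M) x; have := chi_sqr R (x *m M) c.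
  set A := chi (x *m M) x; set B := chi (x *m M) c => hB hA.
  set A1 := chi (a *m M) x; set A2 := chi (b *m M) x.
  set A3 := chi (x *m M) a; set A4 := chi (x *m M) b.
  set A5 := chi (a *m M) c; set A6 := _ * chi (b *m M) c.
  (* The phases [chi (x *m M) x] and [chi (x *m M) c] both occur twice and cancel, so no term
     quadratic in [x] survives. *)
  transitivity (f a * f b * f c * f (a + b + c) * (A5 * A6) *
    (A1 * A2 * (A3 * A4)) * (A * A) * (B * B)); last by rewrite hA hB !mulr1.
  ring.
(* The sum over [x] is [N] if [a + b] lies in the kernel of [M + M^T] and zero otherwise; the
   remaining signs are bounded by one. *)
have e4 : \sum_p G p ^+ 2 <= N ^+ 3 * #|sym_kernel M|%:R.
  rewrite e3.
  have -> : N ^+ 3 * #|sym_kernel M|%:R =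
      \sum_(a : pt n) \sum_(b : pt n) \sum_(c : pt n) (a + b \in sym_kernel M)%:R * N.
    rewrite exprS -mulrA mulr_natl -sumr_const; apply: eq_bigr => a _.
    rewrite (reindex_inj (addrI a)) -sum_indicatorT mulr_sumr; apply: eq_bigr => d _.
    by rewrite addrA mx2 add0r sumr_const -mulr_natl; ring.
  apply: ler_sum => a _; apply: ler_sum => b _; apply: ler_sum => c _.
  rewrite sum_chi inE; set t := (a + b) *m (M + M^T).
  have -> : ((a + b) *m M == (a + b) *m M^T) = (t == 0).
    by apply/eqP/eqP; rewrite /t mulmxDr; [move=> ->; apply: mx2 | apply: mx_addNl].
  case: (t == 0); rewrite ?mulr0 ?mul0r // mul1r.
  rewrite -[leRHS]mul1r; apply: ler_wpM2r; first exact: ltW.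
  apply: sq1_le1.
  have e0 (x y : R) : x * x = 1 -> y * y = 1 -> x * y * (x * y) = 1.
    by move=> hx hy; rewrite mulrACA hx hy mulr1.
  by rewrite !e0 ?chi_sqr.
rewrite e2 in cs.
have N2 : 0 < N ^+ 2 by rewrite exprn_gt0.
rewrite -(ler_pM2l N2) -(ler_pM2l N2).
have -> : N ^+ 2 * (N ^+ 2 * s ^+ 2) = (N ^+ 2 * s) ^+ 2 by ring.
apply: le_trans cs _; rewrite ler_pM2l //; apply: le_trans e4 _.
by rewrite le_eqVlt; apply/orP; left; apply/eqP; ring.
Qed.

Lemma sym_kernel_closed (M : 'M['F_2]_n) : closed_add (sym_kernel M).
Proof.
split=> [|x y]; rewrite !inE ?mul0mx // => /eqP ex /eqP ey.
by rewrite !mulmxDl ex ey.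
Qed.

(** In the Fourier expansion each [W h xi] is multiplied by the sum over [sym_kernel M] of a
    character in [z], which is nonnegative. For [xi = h *m M] this character is trivial by symmetry
    of [M] on the kernel; only these terms are kept. *)
Lemma sum_W_sym_kernel (M : 'M['F_2]_n) :
  #|sym_kernel M|%:R * \sum_h W h (h *m M) <= N * \sum_(z in sym_kernel M) W z (z *m M).
Proof.
rewrite [leRHS]mulr_sumr; under [leRHS]eq_bigr do rewrite W_fourier //.
rewrite exchange_big mulr_sumr /=; apply: ler_sum => h _.
rewrite exchange_big (bigD1 (h *m M)) //= -[leLHS]addr0; apply: lerD.
  rewrite mulr_natl -sumr_const; apply: ler_sum => z; rewrite inE => /eqP e.
  by rewrite [chi (h *m M) z]chiC [chi z _]chi_mulmx -e [chi _ h]chiC chi_sqr mulr1.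
apply: sumr_ge0 => xi _; rewrite -mulr_sumr mulr_ge0 ?W_ge0 //.
rewrite sum_char_subgroup; first by case: ifP.
- exact: mx2.
- exact: sym_kernel_closed.
- by move=> u v; rewrite mulmxDl !chiDr mulrACA.
- by move=> u; rewrite mulrACA !chi_sqr mulr1.
Qed.

(** Where [M] is symmetric the cross terms of [z |-> dot (z *m M) z] cancel, so this map is additive
    and its zeros form a subgroup. By [W_isotropic] no mass is lost outside the zeros. *)
Lemma isotropic_subgroup (M : 'M['F_2]_n) : exists Z : {set pt n},
  [/\ closed_add Z, {in Z, forall z, z *m M = z *m M^T},
      {in Z, forall z, dot (z *m M) z = 0} &
      (\sum_h W h (h *m M)) ^+ 3 <= N ^+ 2 * \sum_(z in Z) W z (z *m M)].
Proof.
set s := \sum_h _; have N0 := npts_gt0 R n.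
pose Z := [set z in sym_kernel M | dot (z *m M) z == 0].
have symZ : {in Z, forall z, z *m M = z *m M^T} by move=> z; rewrite !inE => /andP[/eqP].
exists Z; split=> //.
- have [K0 KD] := sym_kernel_closed M; split=> [|x y].
    by rewrite inE K0 dot0r eqxx.
  move=> xZ yZ; move: (xZ) (yZ); rewrite ![_ \in Z]inE => /andP[xK /eqP ex] /andP[yK /eqP ey].
  rewrite KD //= mulmxDl dotDl !dotDr ex ey addr0 add0r.
  by rewrite [dot (y *m M) x]dotC dot_mulmx -symZ // F2_addbb.
- by move=> z; rewrite !inE => /andP[_ /eqP].
- have -> : \sum_(z in Z) W z (z *m M) = \sum_(z in sym_kernel M) W z (z *m M).
    rewrite [RHS](bigID (fun z => dot (z *m M) z == 0)) /= [X in _ + X]big1 ?addr0.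
      by apply: eq_bigl => z; rewrite inE.
    by move=> z /andP[_]; apply: contraNeq => /W_isotropic ->.
  have h1 := card_sym_kernel M; rewrite -/s in h1.
  have h2 := sum_W_sym_kernel M; rewrite -/s in h2.
  have s0 : 0 <= s by apply: sumr_ge0 => h _; apply: W_ge0.
  rewrite exprSr; apply: le_trans (ler_wpM2r s0 h1) _.
  by rewrite expr2 -!mulrA ler_pM2l.
Qed.

End Linearisation.

(** Summing over [i < j] only replaces the division by two, impossible over F_2, in recovering a
    quadratic form from its alternating polarisation. *)
Definition qform n (A : 'M['F_2]_n) (x : pt n) : 'F_2 :=
  \sum_(i < n) \sum_(j < n | (i < j)%N) x ord0 i * A i j * x ord0 j.

Lemma dot_sum n (A : 'M['F_2]_n) (x y : pt n) :
  dot (x *m A) y = \sum_i \sum_j x ord0 i * A i j * y ord0 j.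
Proof.
rewrite /dot mxE exchange_big; apply: eq_bigr => j _.
by rewrite !mxE mulr_suml.
Qed.

Lemma qformD n (A : 'M['F_2]_n) (x y : pt n) : A^T = A -> (forall i, A i i = 0) ->
  qform A (x + y) = qform A x + qform A y + dot (x *m A) y.
Proof.
move=> symA diagA.
have AC i j : A i j = A j i by rewrite -[in LHS]symA mxE.
pose c i j := x ord0 i * A i j * y ord0 j.
have -> : dot (x *m A) y =
    \sum_(i < n) \sum_(j < n | (i < j)%N) c i j + \sum_(i < n) \sum_(j < n | (i < j)%N) c j i.
  rewrite dot_sum [X in _ + X](exchange_big_dep xpredT) //= -big_split /=.
  apply: eq_bigr => i _; rewrite (bigD1 i) //= diagA mulr0 mul0r add0r.
  rewrite (bigID (fun j : 'I_n => (i < j)%N)) /=; congr (_ + _); apply: eq_bigl => j;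
    by rewrite -val_eqE /=; case: (ltngtP i j).
rewrite /qform -!big_split /=; apply: eq_bigr => i _.
rewrite -!big_split /=; apply: eq_bigr => j _; rewrite /c !mxE (AC j i).
ring.
Qed.

(** * Fourth moments of Fourier coefficients and integration to a quadratic phase *)

Section Integration.
Variables (R : realFieldType) (n : nat).
Local Notation N := (npts R n).
Local Notation chi := (chi R).

Lemma parseval (a : pt n -> R) :
  \sum_eta (\sum_x a x * chi eta x) ^+ 2 = N * \sum_x a x ^+ 2.
Proof.
under eq_bigr => eta _ do rewrite expr2 big_distrlr /=.
rewrite exchange_big mulr_sumr; apply: eq_bigr => x _ /=.
rewrite exchange_big /= (bigD1 x) //= [X in _ + X]big1 ?addr0.
  under eq_bigr => eta _ do rewrite mulrACA chi_sqr mulr1.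
  by rewrite sumr_const mulr_natl -expr2.
move=> y ne; under eq_bigr => eta _.
  rewrite (_ : _ * _ = a x * a y * chi (x + y) eta).
  over.
  by rewrite chiDl [chi x _]chiC [chi y _]chiC; ring.
rewrite -mulr_sumr sum_chi; case: eqP => [/mx_addNl e|]; last by rewrite mulr0.
by rewrite e eqxx in ne.
Qed.

Lemma autocorrelation_fourier (g : pt n -> R) eta :
  (\sum_x g x * chi eta x) ^+ 2 = \sum_h (\sum_x g x * g (x + h)) * chi eta h.
Proof.
rewrite expr2 big_distrlr /=; under [RHS]eq_bigr do rewrite mulr_suml.
rewrite [RHS]exchange_big; apply: eq_bigr => x _ /=.
rewrite (reindex_inj (addrI x)); apply: eq_bigr => h _ /=.
by rewrite chiDr mulrACA [chi eta x * (_ * _)]mulrA chi_sqr mul1r.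
Qed.

(** Parseval's identity for the autocorrelation, whose Fourier transform is the square of that of
    [g]. *)
Lemma sum_autocorrelation_sqr (g : pt n -> R) :
  N * \sum_h (\sum_x g x * g (x + h)) ^+ 2 = \sum_eta (\sum_x g x * chi eta x) ^+ 4.
Proof.
rewrite -parseval; apply: eq_bigr => eta _.
by rewrite -autocorrelation_fourier -exprM.
Qed.

(** The row at zero consists of normalised squared autocorrelations, so its sum is a fourth moment
    of Fourier coefficients: two factors are bounded by [hb], the other two are summed by
    Parseval. *)
Lemma sum_W_row0_le (g : pt n -> R) (beta : R) : (forall x, g x * g x = 1) ->
  (forall eta, (\sum_x g x * chi eta x) ^+ 2 <= beta ^+ 2 * N ^+ 2) ->
  \sum_h W g h 0 <= beta ^+ 2 * N.
Proof.
move=> g2 hb; have N0 := npts_gt0 R n.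
pose c h := \sum_x g x * g (x + h).
have Wc h : N ^+ 2 * W g h 0 = c h ^+ 2.
  rewrite /W exprMn exprVn mulrA mulfV ?mul1r ?expf_neq0 ?gt_eqF //.
  by congr (_ ^+ 2); apply: eq_bigr => x _; rewrite chiC chi0r mulr1.
have pc : N * \sum_h c h ^+ 2 <= beta ^+ 2 * N ^+ 4.
  rewrite sum_autocorrelation_sqr.
  apply: (@le_trans _ _ (\sum_eta beta ^+ 2 * N ^+ 2 * (\sum_x g x * chi eta x) ^+ 2)).
    apply: ler_sum => eta _; rewrite [leLHS](exprD _ 2 2).
    by apply: ler_wpM2r; rewrite ?sqr_ge0.
  rewrite -mulr_sumr parseval (eq_bigr (fun=> 1)) => [|x _]; last by rewrite expr2.
  by rewrite sum1_npts le_eqVlt; apply/orP; left; apply/eqP; ring.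
have N3 : 0 < N ^+ 3 by rewrite exprn_gt0.
rewrite -(ler_pM2l N3) [N ^+ 3]exprS -mulrA mulr_sumr.
under eq_bigr do rewrite Wc.
by apply: le_trans pc _; rewrite le_eqVlt; apply/orP; left; apply/eqP; ring.
Qed.

Definition annihilator (Z : {set pt n}) := [set xi : pt n | [forall z in Z, dot xi z == 0]].

(** Double counting of [chi xi z] over all [xi] and over [z] in [Z]: only [z = 0] survives the sum
    over [xi], while each [xi] in the annihilator contributes [#|Z|]. *)
Lemma card_annihilator (Z : {set pt n}) : closed_add Z ->
  #|annihilator Z|%:R * #|Z|%:R <= N.
Proof.
move=> Zc; have [Z0 ZD] := Zc.
have e : \sum_xi \sum_(z in Z) chi xi z = N.
  rewrite exchange_big (bigD1 0) //= [X in _ + X]big1 ?addr0 => [|z /andP[_ nz]].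
    by rewrite -sum1_npts; apply: eq_bigr => xi _; rewrite chi0r.
  by under eq_bigr do rewrite chiC; rewrite sum_chi (negbTE nz).
rewrite -[leRHS]e mulr_natl -sumr_const [leRHS](bigID (mem (annihilator Z))) /=.
rewrite -[leLHS]addr0; apply: lerD.
  apply: ler_sum => xi; rewrite inE => /forall_inP h.
  rewrite -sum1_card natr_sum; apply: ler_sum => z /h/eqP.
  by rewrite /chi => ->; rewrite sgnF20.
apply: sumr_ge0 => xi _; rewrite sum_char_subgroup //; first by case: ifP.
- exact: mx2.
- exact: chiDr.
- exact: chi_sqr.
Qed.

(* [P *m M *m P^T] is alternating, hence is the polarisation of a quadratic form [q]; multiplying [f] by [(-1)^q] moves the mass of [W] on the graph of [M] into the rows indexed by the annihilator of [Z]. *)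
Lemma integrate (f : pt n -> R) (M : 'M['F_2]_n) (Z : {set pt n}) (beta : R) :
  (forall x, f x * f x = 1) -> closed_add Z ->
  {in Z, forall z, z *m M = z *m M^T} -> {in Z, forall z, dot (z *m M) z = 0} ->
  (forall A eta, (\sum_x f x * sgnF2 R (qform A x + dot eta x)) ^+ 2 <= beta ^+ 2 * N ^+ 2) ->
  (\sum_(z in Z) W f z (z *m M)) ^+ 2 <= beta ^+ 2 * N ^+ 2.
Proof.
move=> f2 Zc symM isoM hb; have [Z0 ZD] := Zc; have N0 := npts_gt0 R n.
have [P [PZ PK]] := subgroup_projection Zc.
(* Conjugation by the projection extends the alternating form from [Z] to the whole space. *)
pose A := P *m M *m P^T.
have dotA x y : dot (x *m A) y = dot (x *m P *m M) (y *m P).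
  by rewrite dot_mulmx /A !mulmxA.
have dotA_C x y : dot (x *m A) y = dot (y *m A) x.
  by rewrite !dotA dotC dot_mulmx -symM.
have dotE (B : 'M['F_2]_n) i j : dot (delta_mx 0 i *m B) (delta_mx 0 j) = B i j.
  by rewrite /dot trmx_delta -rowE -colE !mxE.
have symA : A^T = A.
  by apply/matrixP=> i j; rewrite mxE -dotE dotA_C dotE.
have diagA i : A i i = 0 by rewrite -dotE dotA isoM.
pose g x := f x * sgnF2 R (qform A x).
have g2 x : g x * g x = 1 by rewrite mulrACA f2 sgnF2_sqr mulr1.
have Wg h xi : W g h xi = W f h (xi + h *m A).
  rewrite /W !exprMn; congr (_ * _).
  have -> : \sum_x g x * g (x + h) * chi xi x = sgnF2 R (qform A h) *
      \sum_x f x * f (x + h) * chi (xi + h *m A) x.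
    rewrite mulr_sumr; apply: eq_bigr => x _.
    rewrite /g qformD // !sgnF2D chiDl dotA_C -/(chi (h *m A) x).
    have := sgnF2_sqr R (qform A x); set q := sgnF2 R _ => hq.
    set s := sgnF2 R (qform A h).
    transitivity (q * q * (s * (f x * f (x + h) * (chi xi x * chi (h *m A) x)))).
      by ring.
    by rewrite hq mul1r.
  by rewrite exprMn expr2 sgnF2_sqr mul1r.
(* Rows are translates of the graph of the zero matrix, so the row at zero dominates them all. *)
have hrow xi : \sum_h W g h xi <= beta ^+ 2 * N.
  have -> : \sum_h W g h xi = \sum_h W g h (h *m 0 + xi).
    by apply: eq_bigr => h _; rewrite mulmx0 add0r.
  apply: le_trans (sum_W_graph_le g 0 xi) _.
  rewrite (eq_bigr (fun h => W g h 0)) => [|h _]; last by rewrite mulmx0.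
  apply: sum_W_row0_le => // eta.
  rewrite (eq_bigr (fun x => f x * sgnF2 R (qform A x + dot eta x))) // => x _.
  by rewrite /g sgnF2D mulrA.
set s := \sum_(z in Z) _.
have s0 : 0 <= s by apply: sumr_ge0 => z _; apply: W_ge0.
(* For [z] in [Z] the vector [z *m M + z *m A] annihilates [Z], as [A] and [M] define the same form
   there. *)
have hs1 : s <= #|annihilator Z|%:R * (beta ^+ 2 * N).
  apply: (@le_trans _ _ (\sum_(xi in annihilator Z) \sum_h W g h xi)); last first.
    by rewrite mulr_natl -sumr_const; apply: ler_sum => xi _.
  rewrite exchange_big [leRHS](bigID (mem Z)) /= -[leLHS]addr0; apply: lerD; last first.
    by do 2![apply: sumr_ge0 => ? _]; apply: W_ge0.
  apply: ler_sum => z zZ; rewrite (bigD1 (z *m M + z *m A)) /=; last first.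
    rewrite inE; apply/forall_inP => y yZ.
    by rewrite dotDl dotA !PK // F2_addbb.
  rewrite Wg -addrA mx2 addr0 lerDl; apply: sumr_ge0 => ? _; exact: W_ge0.
have hs2 : s <= #|Z|%:R.
  by rewrite -sum1_card natr_sum; apply: ler_sum => z _; apply: W_le1.
have hZ := card_annihilator Zc.
(* Multiplying the bounds [hs1] and [hs2] removes any dependence on the index of [Z]. *)
apply: (@le_trans _ _ (#|annihilator Z|%:R * (beta ^+ 2 * N) * #|Z|%:R)).
  by rewrite expr2; apply: ler_pM.
rewrite mulrAC; have -> : beta ^+ 2 * N ^+ 2 = N * (beta ^+ 2 * N) by ring.
by apply: ler_wpM2r => //; rewrite mulr_ge0 ?sqr_ge0 // ltW.
Qed.

End Integration.

Lemma inverse_theorem (R : archiRealFieldType) (a : R) : 0 < a ->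
  exists2 c : R, 0 < c & forall n (f : pt n -> R) (beta : R), 0 <= beta ->
    (forall x, f x * f x = 1) ->
    (forall A eta, (\sum_x f x * sgnF2 R (qform A x + dot eta x)) ^+ 2
                   <= beta ^+ 2 * npts R n ^+ 2) ->
    a * npts R n <= \sum_h \sum_xi W f h xi ^+ 2 -> c <= beta.
Proof.
move=> a0; have [C [c [C0 c0 hsub]]] := pd_subgroup a0.
pose d := c ^+ 2 / C; have d0 : 0 < d by rewrite divr_gt0 ?exprn_gt0.
(* The graph carries mass [s >= d * N], and [isotropic_subgroup] cubes the density. *)
exists (d ^+ 3); first by rewrite exprn_gt0.
move=> n f beta b0 f2 hb ha; have N0 := npts_gt0 R n.
(* The symplectic pairing for which [W] is its own Fourier transform. *)
pose ch (u v : pt n * pt n) := chi R u.1 v.2 * chi R u.2 v.1.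
have [|||||||H [Hc hH1 hH2]] := hsub (pt n * pt n)%type (fun v => W f v.1 v.2) ch (npts R n).
- by case=> x y; rewrite pairD !mx2.
- exact: N0.
- by move=> v; rewrite W_ge0 W_le1.
- by rewrite -(pair_bigA _ (fun h xi => W f h xi)) sum_W.
- by move=> u v w; rewrite /ch /= !chiDr mulrACA.
- move=> v; rewrite W_fourier // (pair_bigA _ (fun h xi => W f h xi * _)) /=.
  by apply: eq_bigr.
- by apply: le_trans ha _; rewrite (pair_bigA _ (fun h xi => W f h xi ^+ 2)).
have [M hM] := graph_of_subgroup f2 Hc C0 c0 hH1 hH2; rewrite -/d in hM.
have [Z [Zc symZ isoZ hZ]] := isotropic_subgroup f2 M.
have hi := integrate f2 Zc symZ isoZ hb.
set t := \sum_(z in Z) _ in hZ hi.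
have t0 : 0 <= t by apply: sumr_ge0 => z _; apply: W_ge0.
have h1 : t <= beta * npts R n.
  have bN : 0 <= beta * npts R n by rewrite mulr_ge0 // ltW.
  by move: hi; rewrite -exprMn ler_pXn2r ?nnegrE.
have h2 : (d * npts R n) ^+ 3 <= npts R n ^+ 2 * t.
  have dN : 0 <= d * npts R n by rewrite mulr_ge0 // ltW.
  by apply: le_trans hZ; rewrite lerXn2r ?nnegrE ?(le_trans dN).
have h3 : npts R n ^+ 3 * d ^+ 3 <= npts R n ^+ 3 * beta.
  have N2 : 0 <= npts R n ^+ 2 by rewrite sqr_ge0.
  have := le_trans h2 (ler_wpM2l N2 h1); rewrite exprMn mulrC => h.
  by apply: le_trans h _; rewrite le_eqVlt; apply/orP; left; apply/eqP; ring.
by move: h3; rewrite ler_pM2l ?exprn_gt0.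
Qed.

(** * The hypergraph test *)

Section BoxBound.
Variables (R : realFieldType) (n : nat).
Local Notation N := (npts R n).
Local Notation chi := (chi R).

Lemma sum_pow4_le (I : finType) (a : I -> R) :
  (\sum_i a i) ^+ 4 <= #|I|%:R ^+ 3 * \sum_i a i ^+ 4.
Proof.
have h (b : I -> R) : (\sum_i b i) ^+ 2 <= #|I|%:R * \sum_i b i ^+ 2.
  exact: (sqr_sum_le I b).
have h2 := h (fun i => a i ^+ 2).
rewrite (exprM _ 2 2).
apply: (@le_trans _ _ ((#|I|%:R * \sum_i a i ^+ 2) ^+ 2)).
  have s0 := sqr_ge0 (\sum_i a i).
  by rewrite lerXn2r ?nnegrE ?(le_trans s0).
rewrite exprMn [_ ^+ 3]exprSr -mulrA; apply: ler_wpM2l; first exact: sqr_ge0.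
apply: le_trans h2 _; rewrite le_eqVlt; apply/orP; left; apply/eqP.
by congr (_ * _); apply: eq_bigr => i _; rewrite -exprM.
Qed.

Lemma cs_bounded (I : finType) (b a : I -> R) : (forall i, b i ^+ 2 <= 1) ->
  (\sum_i b i * a i) ^+ 2 <= #|I|%:R * \sum_i a i ^+ 2.
Proof.
move=> hb; apply: le_trans (cauchy_schwarz _ _ _) _; apply: ler_wpM2r.
  by apply: sumr_ge0 => i _; apply: sqr_ge0.
by rewrite -sum1_card natr_sum; apply: ler_sum.
Qed.

Lemma bounded_mul (x y : R) : x ^+ 2 <= 1 -> y ^+ 2 <= 1 -> (x * y) ^+ 2 <= 1.
Proof. by move=> hx hy; rewrite exprMn -[1]mulr1 ler_pM ?sqr_ge0. Qed.

(** A first Cauchy-Schwarz removes [b] and a second removes [b'], leaving the squared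
    autocorrelations of [g]. *)
Lemma rank_one_bound (g b b' : pt n -> R) (z : pt n) :
  (forall x, b x ^+ 2 <= 1) -> (forall x, b' x ^+ 2 <= 1) ->
  (\sum_x \sum_y g (x + y + z) * b x * b' y) ^+ 4 <=
  N ^+ 4 * \sum_eta (\sum_x g x * chi eta x) ^+ 4.
Proof.
move=> hb hb'; have N0 := npts_gt0 R n.
pose c h := \sum_x g x * g (x + h).
pose A x := \sum_y b' y * g (x + y + z).
have -> : \sum_x \sum_y g (x + y + z) * b x * b' y = \sum_x b x * A x.
  apply: eq_bigr => x _; rewrite mulr_sumr; apply: eq_bigr => y _; ring.
have h1 := cs_bounded A hb; rewrite -/N in h1.
have e1 : \sum_x A x ^+ 2 = \sum_(p : pt n * pt n) (b' p.1 * b' p.2) * c (p.1 + p.2).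
  rewrite -(pair_bigA _ (fun y y' => b' y * b' y' * c (y + y'))) /=.
  under eq_bigr => x _ do rewrite /A expr2 big_distrlr /=.
  rewrite exchange_big; apply: eq_bigr => y _ /=.
  rewrite exchange_big; apply: eq_bigr => y' _ /=.
  rewrite mulr_sumr -[RHS](sum_shift _ (y + z)); apply: eq_bigr => x _.
  have -> : x + (y + z) + (y + y') = x + y' + z.
    by rewrite [LHS](AC ((1*2)*2) ((2*4)*(1*5*3))) /= mx2 add0r.
  by rewrite addrA; ring.
have h2 : (\sum_x A x ^+ 2) ^+ 2 <= N ^+ 3 * \sum_h c h ^+ 2.
  rewrite e1; apply: le_trans (cs_bounded _ _) _.
    by move=> p; apply: bounded_mul.
  rewrite card_prod natrM -(pair_bigA _ (fun y y' => c (y + y') ^+ 2)) /=.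
  under eq_bigr => y _ do rewrite (reindex_inj (addrI y)) /=.
  under eq_bigr => y _ do under eq_bigr => w _ do rewrite addrA mx2 add0r.
  by rewrite sumr_const -mulr_natl le_eqVlt; apply/orP; left; apply/eqP; rewrite /npts; ring.
rewrite -sum_autocorrelation_sqr (exprM _ 2 2).
apply: (@le_trans _ _ ((N * \sum_x A x ^+ 2) ^+ 2)).
  have s0 := sqr_ge0 (\sum_i b i * A i).
  by rewrite lerXn2r ?nnegrE ?(le_trans s0).
rewrite exprMn; apply: (@le_trans _ _ (N ^+ 2 * (N ^+ 3 * \sum_h c h ^+ 2))).
  by rewrite ler_wpM2l ?sqr_ge0.
by rewrite le_eqVlt; apply/orP; left; apply/eqP; rewrite /c; ring.
Qed.

(** Cauchy-Schwarz over [(x, y)] removes [b1] and doubles [z] into a pair [p]. Then [f] turns into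
    its derivative along [p.1 + p.2], while [b2] and [b3] become functions of [x] alone and of [y]
    alone, to which [rank_one_bound] applies. *)
Lemma box_bound (f : pt n -> R) (b1 b2 b3 : pt n -> pt n -> R) (c : pt n) :
  (forall x y, b1 x y ^+ 2 <= 1) -> (forall x y, b2 x y ^+ 2 <= 1) ->
  (forall x y, b3 x y ^+ 2 <= 1) ->
  (\sum_x \sum_y \sum_z f (x + y + z + c) * b1 x y * b2 x z * b3 y z) ^+ 8 <=
  N ^+ 23 * \sum_h \sum_xi W f h xi ^+ 2.
Proof.
move=> h1 h2 h3; have N0 := npts_gt0 R n; have N1 : N != 0 by rewrite gt_eqF.
set F := \sum_x _.
pose G (p : pt n * pt n) := \sum_z f (p.1 + p.2 + z + c) * b2 p.1 z * b3 p.2 z.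
pose J (p : pt n * pt n) := \sum_x \sum_y
  (f (x + y + (p.1 + c)) * f (x + y + (p.1 + c) + (p.1 + p.2))) *
  (b2 x p.1 * b2 x p.2) * (b3 y p.1 * b3 y p.2).
have eF : F = \sum_(p : pt n * pt n) b1 p.1 p.2 * G p.
  rewrite -(pair_bigA _ (fun x y => b1 x y * G (x, y))) /=.
  apply: eq_bigr => x _; apply: eq_bigr => y _; rewrite mulr_sumr.
  by apply: eq_bigr => z _ /=; ring.
have hF : F ^+ 2 <= N ^+ 2 * \sum_p J p.
  rewrite eF; apply: le_trans (cs_bounded _ _) _; first by move=> p; apply: h1.
  rewrite card_prod natrM expr2 le_eqVlt; apply/orP; left; apply/eqP; congr (_ * _).
  transitivity (\sum_(p : pt n * pt n) \sum_(q : pt n * pt n)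
    (f (p.1 + p.2 + (q.1 + c)) * f (p.1 + p.2 + (q.1 + c) + (q.1 + q.2))) *
    (b2 p.1 q.1 * b2 p.1 q.2) * (b3 p.2 q.1 * b3 p.2 q.2)); last first.
    by rewrite exchange_big; apply: eq_bigr => q _; rewrite /J pair_bigA.
  apply: eq_bigr => p _; rewrite /G expr2 big_distrlr pair_bigA /=.
  apply: eq_bigr => q _.
  have -> : p.1 + p.2 + (q.1 + c) + (q.1 + q.2) = p.1 + p.2 + q.2 + c.
    by rewrite [LHS](AC (2*2*2) ((3*5)*(1*2*6*4))) /= mx2 add0r.
  by rewrite addrA; ring.
have hJ p : J p ^+ 4 <= N ^+ 8 * \sum_xi W f (p.1 + p.2) xi ^+ 2.
  pose g s := f s * f (s + (p.1 + p.2)).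
  have := @rank_one_bound g (fun x => b2 x p.1 * b2 x p.2) (fun y => b3 y p.1 * b3 y p.2) (p.1 + c).
  rewrite -/(J p) => /(_ (fun x => bounded_mul (h2 _ _) (h2 _ _))).
  move=> /(_ (fun x => bounded_mul (h3 _ _) (h3 _ _))) h.
  apply: le_trans h _; rewrite le_eqVlt; apply/orP; left; apply/eqP.
  rewrite [N ^+ 8](exprD _ 4 4) -mulrA; congr (_ * _); rewrite mulr_sumr.
  apply: eq_bigr => xi _; rewrite /W -exprM exprMn exprVn mulrA mulfV ?mul1r //.
  by rewrite expf_neq0.
have hs : \sum_p J p ^+ 4 <= N ^+ 9 * \sum_h \sum_xi W f h xi ^+ 2.
  apply: (@le_trans _ _ (\sum_(p : pt n * pt n) N ^+ 8 * \sum_xi W f (p.1 + p.2) xi ^+ 2)).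
    exact: ler_sum.
  rewrite -mulr_sumr -(pair_bigA _ (fun z z' => \sum_xi W f (z + z') xi ^+ 2)) /=.
  under eq_bigr => z _ do rewrite (reindex_inj (addrI z)) /=.
  under eq_bigr => z _ do under eq_bigr => w _ do rewrite addrA mx2 add0r.
  by rewrite sumr_const -mulr_natl -/N le_eqVlt; apply/orP; left; apply/eqP; ring.
have h4 := sum_pow4_le J; rewrite card_prod natrM -/N in h4.
rewrite (exprM _ 2 4).
apply: (@le_trans _ _ ((N ^+ 2 * \sum_p J p) ^+ 4)).
  have s0 := sqr_ge0 F.
  by rewrite lerXn2r ?nnegrE ?(le_trans s0).
rewrite exprMn; apply: (@le_trans _ _ ((N ^+ 2) ^+ 4 * ((N * N) ^+ 3 * \sum_p J p ^+ 4))).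
  by apply: ler_wpM2l => //; rewrite exprn_ge0 ?sqr_ge0.
apply: (@le_trans _ _ ((N ^+ 2) ^+ 4 * ((N * N) ^+ 3 * (N ^+ 9 * \sum_h \sum_xi W f h xi ^+ 2)))).
  by do 2![apply: ler_wpM2l; first by rewrite exprn_ge0 ?sqr_ge0 // mulr_ge0 // ltW].
(* The powers of [N] add up to [8 + 6 + 9 = 23]. *)
by rewrite le_eqVlt; apply/orP; left; apply/eqP; ring.
Qed.

End BoxBound.

(** * Polynomials of degree at most two *)

Section QuadraticPolynomials.
Variable n : nat.
Implicit Types (p : {mpoly 'F_2[n]}) (x y z : pt n).

Local Notation ev p x := (p.@[fun i => x ord0 i]).

(** In characteristic two the alternating sum over the vertices of a parallelepiped loses its
    signs. *)
Definition third_difference (h : pt n -> 'F_2) x y z : 'F_2 :=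
  h x + h y + h z + h (x + y) + h (x + z) + h (y + z) + h (x + y + z) + h 0.

(** The third difference is linear in the function, so it suffices to treat monomials of degree at
    most two. *)
Lemma third_difference_quadratic p x y z : (msize p <= 3)%N ->
  third_difference (fun x => ev p x) x y z = 0.
Proof.
move=> hp.
have TD (h g : pt n -> 'F_2) :
    third_difference (fun x => h x + g x) x y z =
    third_difference h x y z + third_difference g x y z.
  by rewrite /third_difference; ring.
have TZ c (h : pt n -> 'F_2) :
    third_difference (fun x => c * h x) x y z = c * third_difference h x y z.
  by rewrite /third_difference; ring.
have T1 : third_difference (fun=> 1) x y z = 0 by apply: val_inj.
have TX i : third_difference (fun x => x ord0 i) x y z = 0.
  rewrite /third_difference !mxE; set a := x _ _; set b := y _ _; set c := z _ _.
  transitivity ((a + b + c + (a + b + c)) + (a + b + c + (a + b + c))); first by ring.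
  by rewrite !F2_addbb.
have TXX i j : third_difference (fun x => x ord0 i * x ord0 j) x y z = 0.
  rewrite /third_difference !mxE.
  set a := x _ i; set b := y _ i; set c := z _ i.
  set d := x _ j; set e := y _ j; set f := z _ j.
  (* Products such as [a * d] occur four times and mixed ones such as [a * e] twice, so the whole
     sum is [w + w]. *)
  pose w := 2 * (a * d + b * e + c * f) + (a * e + a * f + b * d + b * f + c * d + c * e).
  by transitivity (w + w); [rewrite /w; ring | rewrite F2_addbb].
have TM m : (mdeg m <= 2)%N -> third_difference (fun x => ev 'X_[m] x) x y z = 0.
  move=> hm; have [->|nz] := eqVneq m 0%MM.
    rewrite -[RHS]T1 /third_difference; by rewrite mpolyX0 !meval1.
  have [i hi] : exists i, m i != 0%N.
    apply/existsP; apply: contraNT nz; rewrite negb_exists => /forallP h.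
    by apply/eqP/mnmP=> i; rewrite mnm0E; apply/eqP; have := h i; rewrite negbK.
  have em : m = (U_(i) + (m - U_(i)))%MM.
    by rewrite addmC submK //; apply/mnm_lepP=> j; rewrite mnm1E; case: eqP => // <-; rewrite lt0n.
  have hm' : (mdeg (m - U_(i)) <= 1)%N.
    by move: hm; rewrite {1}em mdegD mdeg1.
  move: em hm'; set m' := (m - _)%MM => -> hm'.
  rewrite /third_difference !mpolyXD !mevalM !mevalXU.
  have [e0|] := eqVneq (mdeg m') 0%N.
    move/eqP: e0; rewrite mdeg_eq0 => /eqP ->; rewrite mpolyX0 !meval1 !mulr1.
    exact: TX.
  move=> ne; have /mdeg1P[j /eqP ->] : mdeg m' == 1%N by move: hm' ne; case: (mdeg m') => [|[]].
  by rewrite !mevalXU; apply: TXX.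
have -> : third_difference (fun x => ev p x) x y z =
   \sum_(m <- msupp p) p@_m * third_difference (fun x => ev 'X_[m] x) x y z.
  rewrite {1}[p]mpolyE.
  have evS v : ev (\sum_(m <- msupp p) p@_m *: 'X_[m]) v = \sum_(m <- msupp p) p@_m * ev 'X_[m] v.
    by rewrite raddf_sum; apply: eq_bigr => m _ /=; rewrite mevalZ.
  rewrite /third_difference !evS -!big_split; apply: eq_bigr => m _ /=; ring.
rewrite big_seq big1 // => m hm; rewrite TM ?mulr0 //.
by have := msize_mdeg_lt hm; move: hp; case: (msize p) => // k; lia.
Qed.

Definition qpoly (A : 'M['F_2]_n) (eta : pt n) (c : 'F_2) : {mpoly 'F_2[n]} :=
  \sum_(i < n) \sum_(j < n | (i < j)%N) A i j *: 'X_[U_(i) + U_(j)]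
  + \sum_(i < n) eta ord0 i *: 'X_i + c%:MP.

Lemma qpolyE A eta c x : ev (qpoly A eta c) x = qform A x + dot eta x + c.
Proof.
rewrite /qpoly !mevalD mevalC; congr (_ + _ + _).
  rewrite raddf_sum; apply: eq_bigr => i _; rewrite raddf_sum; apply: eq_bigr => j _ /=.
  by rewrite mevalZ mpolyXD mevalM !mevalXU; ring.
rewrite raddf_sum /dot mxE; apply: eq_bigr => i _ /=.
by rewrite mevalZ mevalXU mxE.
Qed.

Lemma msize_qpoly A eta c : (msize (qpoly A eta c) <= 3)%N.
Proof.
have mono c' i j : (msize (c' *: 'X_[U_(i) + U_(j)] : {mpoly 'F_2[n]}) <= 3)%N.
  by apply: leq_trans (msizeZ_le _ _) _; rewrite msizeX mdegD !mdeg1.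
have lin c' i : (msize (c' *: 'X_i : {mpoly 'F_2[n]}) <= 3)%N.
  by apply: leq_trans (msizeZ_le _ _) _; rewrite msizeX mdeg1.
have sum_le (I : finType) (P : pred I) (F : I -> {mpoly 'F_2[n]}) :
    (forall i, msize (F i) <= 3)%N -> (msize (\sum_(i | P i) F i) <= 3)%N.
  move=> h; apply: leq_trans (msize_sum _ _ _) _.
  by apply/bigmax_leqP_seq => i _ _.
rewrite /qpoly; apply: leq_trans (msizeD_le _ _) _; rewrite geq_max.
apply/andP; split; last by rewrite msizeC; case: (c != 0).
apply: leq_trans (msizeD_le _ _) _; rewrite geq_max; apply/andP; split.
  by apply: (sum_le) => i; apply: sum_le.
exact: sum_le.
Qed.

End QuadraticPolynomials.

Lemma indicator_sign (R : realFieldType) (s : R) : s * s = 1 ->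
  (s == 1)%:R = 2^-1 + 2^-1 * s.
Proof.
move=> s2; have /eqP : (s - 1) * (s + 1) = 0 by rewrite -subr_sqr expr2 s2 expr1n subrr.
rewrite mulf_eq0 subr_eq0 addr_eq0 => /orP[/eqP ->|/eqP ->].
  by rewrite eqxx /=; lra.
by case: eqP => [h|_]; [exfalso; lra | rewrite /=; lra].
Qed.

(** * Expansion of the acceptance probability edge by edge *)

Section HypergraphTest.
Variables (R : realFieldType) (n t : nat) (f : pt n -> R).
Hypothesis f2 : forall x, f x * f x = 1.
Local Notation N := (npts R n).
Local Notation point := {ffun 'I_t -> pt n}.
Implicit Types (e : {set 'I_t}) (E : {set {set 'I_t}}) (xs : point).

(** The empty subset contributes [f 0], so the test equation on an edge becomes [edge_val e xs = 1],
    with no ordering of the vertices involved. *)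
Definition edge_val e xs : R := \prod_(s in powerset e) f (\sum_(i in s) xs i).

Lemma big_powersetU1 (F : {set 'I_t} -> R) i e : i \notin e ->
  \prod_(s in powerset (i |: e)) F s =
  (\prod_(s in powerset e) F s) * \prod_(s in powerset e) F (i |: s).
Proof.
move=> hi; rewrite (bigID (fun s : {set 'I_t} => i \in s)) /= mulrC; congr (_ * _).
  apply: eq_bigl => s; rewrite !inE; apply/andP/idP => [[h his]|h].
    apply/subsetP=> j hj; have := subsetP h j hj; rewrite !inE => /orP[/eqP e1|//].
    by rewrite -e1 hj in his.
  split; first by apply: subset_trans h _; apply: subsetUr.
  by apply: contra hi => /(subsetP h).
rewrite [LHS](reindex_onto (fun s => i |: s) (fun s => s :\ i)) /=; last first.
  by move=> s /andP[_ hs]; rewrite setD1K.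
apply: eq_bigl => s; rewrite !inE eqxx andbT.
apply/andP/idP => [[h /eqP es]|h].
  rewrite -es; apply/subsetP=> j; rewrite !inE => /andP[ji /orP[/eqP e1|hj]].
    by rewrite e1 eqxx in ji.
  have : j \in i |: e by apply: (subsetP h); rewrite inE hj orbT.
  by rewrite !inE (negbTE ji).
split; first exact: setUS.
by rewrite setU1K //; apply: contra hi => /(subsetP h).
Qed.

Lemma edge_val3 i j k xs : i != j -> i != k -> j != k ->
  edge_val [set i; j; k] xs =
  f 0 * (f (xs i) * f (xs j) * f (xs k) * f (xs i + xs j) * f (xs i + xs k) *
         f (xs j + xs k) * f (xs i + xs j + xs k)).
Proof.
move=> ij ik jk.
have -> : [set i; j; k] = k |: (j |: (i |: set0)).
  by apply/setP=> l; rewrite !inE orbF; do !case: (_ == _).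
have [ji ki kj] : [/\ j != i, k != i & k != j] by rewrite ![_ == i]eq_sym [k == j]eq_sym.
rewrite /edge_val !big_powersetU1 ?inE ?negb_or ?orbF ?ji ?ki ?kj //.
rewrite powerset0 !big_set1 !big_setU1 ?inE ?negb_or ?orbF ?big_set0 ?ji ?ki ?kj //=.
rewrite !addr0 [xs k + (_ + _)]addrC [xs j + xs i]addrC [xs k + xs i]addrC [xs k + xs j]addrC.
ring.
Qed.

Definition all_edges E xs := [forall e in E, edge_val e xs == 1].

Lemma card3_ex e : #|e| = 3%N ->
  exists i j k, [/\ i != j, i != k, j != k & e = [set i; j; k]].
Proof.
move=> h3; have /set0Pn[i ie] : e != set0 by rewrite -card_gt0 h3.
have /cards2P[j [k [jk ejk]]] : #|e :\ i| == 2%N.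
  by have := cardsD1 i e; rewrite ie h3; case: #|_| => [|[|[|]]].
have hj : j \in e :\ i by rewrite ejk !inE eqxx.
have hk : k \in e :\ i by rewrite ejk !inE eqxx orbT.
move: hj hk; rewrite !inE => /andP[ji _] /andP[ki _].
exists i, j, k; split=> //; rewrite 1?eq_sym //.
by rewrite -(setD1K ie) ejk setUA.
Qed.

Lemma card3_distinct (i j k : 'I_t) : #|[set i; j; k]| = 3%N -> [/\ i != j, i != k & j != k].
Proof.
move=> h; have h2 (a b : 'I_t) : [set i; j; k] \subset [set a; b] -> False.
  by move/subset_leq_card; rewrite h cards2; case: (a != b).
split; apply/negP=> /eqP e; [apply: (h2 i k)|apply: (h2 i j)|apply: (h2 i j)];
  by apply/subsetP=> l; rewrite !inE e; do !case: (_ == _).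
Qed.

Lemma acceptsE E xs : three_uniform E -> accepts E f xs = all_edges E xs.
Proof.
move=> E3; apply/forall_inP/forall_inP => h e eE; have := h e eE.
  have [i [j [k [ij ik jk ee]]]] := card3_ex (E3 e eE).
  move/forallP/(_ i)/forallP/(_ j)/forallP/(_ k); rewrite ee eqxx /=.
  by rewrite /edge_ok edge_val3 // => /eqP ->; rewrite f2.
move=> /eqP he; apply/forallP=> i; apply/forallP=> j; apply/forallP=> k.
apply/implyP=> /eqP ee; have := E3 e eE; rewrite ee => /card3_distinct[ij ik jk].
move: he; rewrite ee edge_val3 // => he; apply/eqP.
by have := congr1 ( *%R (f 0)) he; rewrite mulrA f2 mul1r mulr1.
Qed.

Lemma eq_edge_val e xs xs' : {in e, xs =1 xs'} -> edge_val e xs = edge_val e xs'.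
Proof.
move=> h; apply: eq_bigr => s; rewrite inE => /subsetP se.
by congr f; apply: eq_bigr => i /se; apply: h.
Qed.

Lemma eq_all_edges E xs xs' : (forall e, e \in E -> {in e, xs =1 xs'}) ->
  all_edges E xs = all_edges E xs'.
Proof.
by move=> h; apply: eq_forallb_in => e eE; rewrite (eq_edge_val (h e eE)).
Qed.

Lemma edge_val_sqr e xs : edge_val e xs * edge_val e xs = 1.
Proof. by rewrite -big_split big1 //= => s _; rewrite f2. Qed.

Variable beta : R.
Hypothesis beta_ge0 : 0 <= beta.
Hypothesis box : forall (b1 b2 b3 : pt n -> pt n -> R) (c : pt n),
  (forall x y, b1 x y ^+ 2 <= 1) -> (forall x y, b2 x y ^+ 2 <= 1) ->
  (forall x y, b3 x y ^+ 2 <= 1) ->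
  \sum_x \sum_y \sum_z f (x + y + z + c) * b1 x y * b2 x z * b3 y z <= beta * N ^+ 3.

Let shift (i j k : 'I_t) (x y z : pt n) : point :=
  [ffun l => if l == i then x else if l == j then y else if l == k then z else 0].

(* With all coordinates outside [e0] fixed, every other edge misses one of the three vertices of [e0], so its indicator depends on at most two of the three free coordinates. *)
Lemma correlation_with_edge e0 E : #|e0| = 3%N -> three_uniform E -> e0 \notin E ->
  \sum_xs (all_edges E xs)%:R * edge_val e0 xs <= beta * #|{: point}|%:R.
Proof.
move=> he0c E3 he0; have [i [j [k [ij ik jk e0E]]]] := card3_ex he0c.
have N0 := npts_gt0 R n; have N3 : 0 < N ^+ 3 by rewrite exprn_gt0.
have [ji ki kj] : [/\ j != i, k != i & k != j] by rewrite ![_ == i]eq_sym [k == j]eq_sym.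
pose Phi xs := (all_edges E xs)%:R * edge_val e0 xs.
(* Translating the three coordinates of [e0] permutes the points, so averaging over all translations
   keeps the sum. *)
have shifted : N ^+ 3 * \sum_xs Phi xs =
    \sum_(xs : point) \sum_x \sum_y \sum_z Phi (xs + shift i j k x y z).
  have -> : N ^+ 3 * \sum_xs Phi xs =
     \sum_(x : pt n) \sum_(y : pt n) \sum_(z : pt n) \sum_xs Phi xs.
    by rewrite !sumr_const -!mulrnA -[RHS]mulr_natl !natrM -/N; ring.
  rewrite [RHS]exchange_big; apply: eq_bigr => x _.
  rewrite [RHS]exchange_big; apply: eq_bigr => y _.
  rewrite [RHS]exchange_big; apply: eq_bigr => z _.
  have inj : injective (fun xs : point => xs + shift i j k x y z) by move=> xs xs' /addIr.
  by rewrite [LHS](reindex_inj inj).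
rewrite -(ler_pM2l N3) shifted.
have -> : N ^+ 3 * (beta * #|{: point}|%:R) = \sum_(xs : point) beta * N ^+ 3.
  by rewrite sumr_const -[RHS]mulr_natl; ring.
apply: ler_sum => xs _.
(* Edges are sorted by a vertex of [e0] that they miss: [k] for [E1], [j] for [E2], and [i] for
   [E4], since an edge containing all three would be [e0] itself. *)
pose E1 := [set e in E | k \notin e].
pose E2 := [set e in E | (k \in e) && (j \notin e)].
pose E4 := [set e in E | (k \in e) && (j \in e)].
have accE X : all_edges E X = [&& all_edges E1 X, all_edges E2 X & all_edges E4 X].
  apply/forall_inP/and3P => [h|[/forall_inP h1 /forall_inP h2 /forall_inP h4] e eE].
    by split; apply/forall_inP=> e; rewrite inE => /andP[/h].
  have [ke|ke] := boolP (k \in e); last by apply: h1; rewrite inE eE.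
  have [je|je] := boolP (j \in e); first by apply: h4; rewrite inE eE ke.
  by apply: h2; rewrite inE eE ke.
(* The factors of [edge_val e0], except the value at the sum of all three vertices, are shared out
   likewise. *)
pose b1 x y := f 0 * f (xs i + x) * f (xs j + y) * f (xs i + x + (xs j + y)) *
  (all_edges E1 (xs + shift i j k x y 0))%:R.
pose b2 x z := f (xs k + z) * f (xs i + x + (xs k + z)) *
  (all_edges E2 (xs + shift i j k x 0 z))%:R.
pose b3 y z := f (xs j + y + (xs k + z)) * (all_edges E4 (xs + shift i j k 0 y z))%:R.
have fb x : f x ^+ 2 <= 1 by rewrite expr2 f2.
have bb (b : bool) : (b%:R : R) ^+ 2 <= 1 by case: b; rewrite ?expr1n ?expr0n.
have hb1 x y : b1 x y ^+ 2 <= 1 by rewrite /b1; do !apply: bounded_mul.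
have hb2 x y : b2 x y ^+ 2 <= 1 by rewrite /b2; do !apply: bounded_mul.
have hb3 x y : b3 x y ^+ 2 <= 1 by rewrite /b3; do !apply: bounded_mul.
apply: le_trans (box (xs i + xs j + xs k) hb1 hb2 hb3).
rewrite le_eqVlt; apply/orP; left; apply/eqP.
apply: eq_bigr => x _; apply: eq_bigr => y _; apply: eq_bigr => z _.
rewrite /Phi e0E edge_val3 // accE.
have -> : all_edges E1 (xs + shift i j k x y z) = all_edges E1 (xs + shift i j k x y 0).
  apply: eq_all_edges => e; rewrite inE => /andP[_ ke] l le; rewrite !ffunE.
  case: (l == i); case: (l == j) => //; case: eqP => // lk.
  by rewrite -lk le in ke.
have -> : all_edges E2 (xs + shift i j k x y z) = all_edges E2 (xs + shift i j k x 0 z).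
  apply: eq_all_edges => e; rewrite inE => /and3P[_ _ je] l le; rewrite !ffunE.
  case: (l == i) => //; case: eqP => // lj.
  by rewrite -lj le in je.
have -> : all_edges E4 (xs + shift i j k x y z) = all_edges E4 (xs + shift i j k 0 y z).
  apply: eq_all_edges => e; rewrite inE => /and3P[eE ke je] l le; rewrite !ffunE.
  case: eqP => // li; rewrite li in le; case/negP: he0; suff -> : e0 = e by [].
  rewrite e0E; apply/eqP; rewrite eqEcard (E3 e eE) -e0E he0c leqnn andbT e0E.
  by rewrite !subUset !sub1set le je ke.
rewrite !ffunE !eqxx (negbTE ji) (negbTE ki) (negbTE kj).
rewrite -!mulnb !natrM /b1 /b2 /b3.
have -> : x + y + z + (xs i + xs j + xs k) = xs i + x + (xs j + y) + (xs k + z).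
  by rewrite [LHS](AC (3*3) ((4*1)*(5*2)*(6*3))).
ring.
Qed.

(** Remove one edge and write its indicator as [(1 + edge_val) / 2]. The main term halves, and the
    new error is the average of the inherited one and of a correlation, each at most [beta]; hence
    errors do not accumulate with the number of edges. *)
Lemma sum_all_edges_le E : three_uniform E ->
  \sum_xs (all_edges E xs)%:R <= ((2 ^+ #|E|)^-1 + beta) * #|{: point}|%:R.
Proof.
have [m] := ubnP #|E|; elim: m E => // m IH E ltEm E3.
have T0 : 0 <= #|{: point}|%:R :> R by [].
have [->|[e0 he0]] := set_0Vmem E.
  rewrite cards0 expr0 invr1; apply: (@le_trans _ _ (\sum_(xs : point) 1)).
    by apply: ler_sum => xs _; case: all_edges.
  by rewrite sumr_const mulrDl mul1r lerDl mulr_ge0.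
set E' := E :\ e0.
have E'3 : three_uniform E' by move=> e; rewrite !inE => /andP[_ /E3].
have cE : #|E| = #|E'|.+1 by rewrite (cardsD1 e0 E) he0.
rewrite cE ltnS in ltEm; have IHE := IH E' ltEm E'3.
have hc := correlation_with_edge (E3 _ he0) E'3 (negbT (setD11 e0 E)).
have accE xs : (all_edges E xs)%:R =
    2^-1 * (all_edges E' xs)%:R + 2^-1 * ((all_edges E' xs)%:R * edge_val e0 xs) :> R.
  have -> : all_edges E xs = (edge_val e0 xs == 1) && all_edges E' xs.
    apply/forall_inP/andP => [h|[h1 /forall_inP h2] e eE].
      by split; [apply: h | apply/forall_inP=> e; rewrite !inE => /andP[_]; apply: h].
    by have [->//|ne] := eqVneq e e0; apply: h2; rewrite !inE ne.
  case: (all_edges E' xs); rewrite ?andbT ?andbF ?mul0r ?mulr0 ?addr0 //=.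
  by rewrite indicator_sign ?edge_val_sqr // mulr1 mul1r.
under eq_bigr do rewrite accE.
rewrite big_split /= -!mulr_sumr cE exprS invfM.
set T : R := #|_|%:R in T0 IHE hc *; set p := (2 ^+ #|E'|)^-1 in IHE *.
have -> : (2^-1 * p + beta) * T = 2^-1 * ((p + beta) * T) + 2^-1 * (beta * T) by field.
by apply: lerD; apply: ler_wpM2l; rewrite ?invr_ge0.
Qed.

End HypergraphTest.

Lemma quad_fun_qpoly (R : nzRingType) n (A : 'M['F_2]_n) eta c :
  quad_fun (fun x : pt n => sgnF2 R (qform A x + dot eta x + c)).
Proof. by exists (qpoly A eta c); split; [apply: msize_qpoly | move=> x; rewrite qpolyE]. Qed.

(** * From distance to correlation, and the conclusion *)

Section Soundness.
Variables (R : realType) (n : nat) (f : pt n -> R).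
Hypothesis f_sign : forall x, f x = 1 \/ f x = -1.
Local Notation N := (npts R n).

Lemma sign_sqr x : f x * f x = 1.
Proof. by case: (f_sign x) => ->; rewrite ?mulrNN mulr1. Qed.

Lemma correlation_dist (g : pt n -> R) : (forall x, g x = 1 \/ g x = -1) ->
  \sum_x f x * g x = N * (1 - 2 * dist f g).
Proof.
move=> hg; have N1 : N != 0 by rewrite gt_eqF // npts_gt0.
rewrite /dist -/N; set D := [set x | _].
have -> : N * (1 - 2 * (#|D|%:R / N)) = N - 2 * #|D|%:R by field.
rewrite -sum1_npts -sum_indicatorT mulr_sumr -sumrB; apply: eq_bigr => x _.
rewrite inE; case: (f_sign x) => ->; case: (hg x) => ->; case: eqP => h /=; lra.
Qed.

(** The distance hypothesis bounds correlations from above only; applying it also to the negated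
    phase, with constant term 1, bounds the absolute value. *)
Lemma quadratic_correlation_le eps A eta : 
  (forall g : pt n -> R, quad_fun g -> 2^-1 - eps <= dist f g) ->
  (\sum_x f x * sgnF2 R (qform A x + dot eta x)) ^+ 2 <= (2 * eps) ^+ 2 * N ^+ 2.
Proof.
move=> hq; have N0 := npts_gt0 R n.
have sgn1 (b : 'F_2) : sgnF2 R b = 1 \/ sgnF2 R b = -1.
  by rewrite /sgnF2; case: ifP; [left|right].
have bound c : \sum_x f x * sgnF2 R (qform A x + dot eta x + c) <= 2 * eps * N.
  rewrite (correlation_dist (g := fun x => sgnF2 R (qform A x + dot eta x + c))) //.
  rewrite mulrC ler_pM2r //; have := hq _ (quad_fun_qpoly R A eta c); lra.
have h0 := bound 0; have h1 := bound 1.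
have s1 : sgnF2 R 1 = -1 by [].
rewrite (eq_bigr (fun x => f x * sgnF2 R (qform A x + dot eta x))) in h0; last first.
  by move=> x _; rewrite addr0.
rewrite (eq_bigr (fun x => - (f x * sgnF2 R (qform A x + dot eta x)))) in h1; last first.
  by move=> x _; rewrite sgnF2D s1 mulrN1 mulrN.
rewrite sumrN in h1; set S := \sum_x _ in h0 h1 *.
rewrite -exprMn -ler_sqrt ?sqr_ge0 // !sqrtr_sqr.
apply: le_trans (ler_norm _); rewrite ler_norml h0 andbT; lra.
Qed.

End Soundness.

Lemma test_soundness (R : realType) (delta : R) : 0 < delta ->
  exists2 eta : R, 0 < eta & forall n t (E : {set {set 'I_t}}) (f : pt n -> R) (eps : R),
    three_uniform E -> (forall x, f x = 1 \/ f x = -1) -> 0 < eps < eta ->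
    (forall g : pt n -> R, quad_fun g -> 2^-1 - eps <= dist f g) ->
    acc_prob E f <= (2 ^+ #|E|)^-1 + delta.
Proof.
(* [box_bound] controls an eighth power, whence [delta ^+ 8]. *)
move=> d0; have [c c0 hc] := inverse_theorem (exprn_gt0 8 d0).
(* The correlation bound is [beta = 2 * eps], which must stay below [c]. *)
exists (c / 2); first by rewrite divr_gt0.
move=> n t E f eps E3 f_sign /andP[e0 he] hq.
have N0 := npts_gt0 R n; have f2 := sign_sqr f_sign.
have small : \sum_h \sum_xi W f h xi ^+ 2 <= delta ^+ 8 * npts R n.
  rewrite leNgt; apply/negP => /ltW h.
  have := hc n f (2 * eps) (mulr_ge0 (ler0n _ 2) (ltW e0)) f2
    (fun A eta => quadratic_correlation_le f_sign A eta hq) h.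
  by lra.
rewrite /acc_prob ler_pdivrMr; last first.
  by rewrite ltr0n; apply/card_gt0P; exists [ffun=> 0].
rewrite -sum_indicatorT.
rewrite (eq_bigr (fun xs => (all_edges f E xs)%:R)); last first.
  by move=> xs _; rewrite inE acceptsE.
apply: sum_all_edges_le => //; first exact: ltW.
move=> b1 b2 b3 k h1 h2 h3; have := box_bound f k h1 h2 h3.
set F := \sum_x _ => hF.
rewrite leNgt; apply/negP => lt.
have B0 : 0 <= delta * npts R n ^+ 3 by rewrite mulr_ge0 ?exprn_ge0 // ltW.
have : (delta * npts R n ^+ 3) ^+ 8 < F ^+ 8 by rewrite ltrXn2r ?nnegrE // ltW // (le_lt_trans B0).
rewrite ltNge; apply/negP; rewrite negbK; apply: le_trans hF _.
have -> : (delta * npts R n ^+ 3) ^+ 8 = npts R n ^+ 23 * (delta ^+ 8 * npts R n) by ring.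
by apply: ler_wpM2l => //; rewrite exprn_ge0 // ltW.
Qed.

Lemma test_completeness (R : realType) n t (E : {set {set 'I_t}}) (f : pt n -> R) :
  quad_fun f -> acc_prob E f = 1.
Proof.
case=> P [hP hf].
have all_acc xs : accepts E f xs.
  apply/forall_inP=> e _; apply/forallP=> i; apply/forallP=> j; apply/forallP=> k.
  apply/implyP=> _; rewrite /edge_ok !hf -!sgnF2D; apply/eqP; congr (sgnF2 R _).
  have := third_difference_quadratic (xs i) (xs j) (xs k) hP.
  rewrite /third_difference => h; apply: (addIr P.@[fun l => (0 : pt n) ord0 l]).
  by rewrite F2_addbb.
rewrite /acc_prob (_ : [set xs | _] = setT) ?cardsT.
  rewrite divff // pnatr_eq0 -lt0n; apply/card_gt0P; by exists [ffun=> 0].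
by apply/setP=> xs; rewrite !inE all_acc.
Qed.

Theorem theorem3p3 (R : realType) :
  (* (i) completeness *)
  (forall (n t : nat) (E : {set {set 'I_t}}) (f : pt n -> R),
      three_uniform E -> quad_fun f -> acc_prob E f = 1)
  /\
  (* (ii) soundness, with phi independent of n, t, H *)
  (exists phi : R -> R,
      (forall eps, 0 < eps <= 2^-1 -> 0 <= phi eps) /\
      (forall delta, 0 < delta -> exists eta, 0 < eta /\
          forall eps, 0 < eps <= 2^-1 -> eps < eta -> phi eps < delta) /\
      (forall (n t : nat) (E : {set {set 'I_t}}) (f : pt n -> R) (eps : R),
          three_uniform E ->
          (forall x, f x = 1 \/ f x = -1) ->
          0 < eps <= 2^-1 ->
          (forall g : pt n -> R, quad_fun g -> 2^-1 - eps <= dist f g) ->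
          acc_prob E f <= (2 ^+ #|E|)^-1 + phi eps)).
Proof.
split=> [n t E f _|]; first exact: test_completeness.
(* [phi eps] is the supremum of the excess over all [n], [t], [E] and [f], which makes it uniform;
   including 0 makes the set nonempty and [phi] nonnegative. *)
pose excess (eps : R) : R -> Prop := fun r => r = 0 \/
  exists n t (E : {set {set 'I_t}}) (f : pt n -> R),
    [/\ three_uniform E, forall x, f x = 1 \/ f x = -1,
        forall g : pt n -> R, quad_fun g -> 2^-1 - eps <= dist f g &
        r = acc_prob E f - (2 ^+ #|E|)^-1].
have ne eps : classical_sets.nonempty (excess eps) by exists 0; left.
have bd eps : classical_sets.has_ubound (excess eps).
  exists 1 => r [->//|[n [t [E [f [_ _ _ ->]]]]]].
  rewrite lerBlDr; apply: (@le_trans _ _ 1); last by rewrite lerDl invr_ge0 exprn_ge0.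
  rewrite /acc_prob ler_pdivrMr ?mul1r ?ler_nat ?max_card //.
  by rewrite ltr0n; apply/card_gt0P; exists [ffun=> 0].
exists (fun eps => sup (excess eps)); split; [|split].
- by move=> eps _; apply: ub_le_sup => //; left.
(* A supremum preserves only weak bounds, so soundness is applied with [delta / 2]. *)
- move=> delta d0; have d2 : 0 < delta / 2 by rewrite divr_gt0.
  have [eta eta0 h] := test_soundness d2; exists eta; split=> // eps /andP[e0 _] he.
  apply: (@le_lt_trans _ _ (delta / 2)); last by lra.
  apply: ge_sup => // r [->|[n [t [E [f [E3 fs hq ->]]]]]]; first exact: ltW.
  by rewrite lerBlDl; apply: h hq; rewrite ?e0.
- move=> n t E f eps E3 fs _ hq; rewrite -lerBlDl; apply: ub_le_sup => //.
  by right; exists n, t, E, f.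
Qed.
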